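(* Let $\epsilon_B\in\{1,-1\}$ and let $B=\mathrm{diag}(B_+,B_-)$ be one of the block-diagonal $4\times 4$ matrices listed in the context, of type $\gamma=1$ or $\gamma=-1$. Consider the matrix AKNS initial-boundary value problem on the half-line $$iQ_t+Q_{xx}-2QRQ=0,\qquad -iR_t+R_{xx}-2RQR=0,\qquad x>0,\ t>0,$$ for $Q=\mathrm{diag}(q^{(1)},q^{(2)})$, $R=\mathrm{diag}(r^{(1)},r^{(2)})$, with initial data $Q(x,0)=Q_0(x)$, $R(x,0)=R_0(x)$ and boundary data $G_0(t)=Q(0,t)$, $G_1(t)=Q_x(0,t)$, $H_0(t)=R(0,t)$, $H_1(t)=R_x(0,t)$ satisfying, with $\sigma=\begin{pmatrix}0&1\\1&0\end{pmatrix}$, $$G_0-\sigma G_0\sigma=0,\quad G_1+\sigma G_1\sigma=0,\quad H_0-\sigma H_0\sigma=0,\quad H_1+\sigma H_1\sigma=0 .$$ Impose on this problem the local $\mathbb{Z}_2$ reduction $$U(x,t,k)=\epsilon_B\,B\,U^\dagger(x,t,\sigma_s(k))\,B^{-1},\qquad \sigma_s(k)=-k^*/\epsilon_B,$$ on the $4\times4$ Lax matrix $U$ (equivalently, $R(x,t)=\epsilon_B B_-Q^\dagger(x,t)B_+^{-1}$). Then the NLS equation and the nonlocal NLS equation on the full line both arise as this reduction, in the following sense. Let $q$ be the function on the full line given by $$q(x,t)=q^{(1)}(x,t),\qquad q(-x,t)=q^{(2)}(x,t),\qquad x\ge0 .$$ (1) If $\gamma=1$, the reduced problem is the NLS equation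 on the line: $$iq_t(x,t)+q_{xx}(x,t)-2\epsilon_B\frac{\rho^-}{\rho^+}\,|q(x,t)|^2q(x,t)=0,\qquad x\in\mathbb{R}.$$ (2) If $\gamma=-1$, the reduced problem is the nonlocal NLS equation on the line: $$iq_t(x,t)+q_{xx}(x,t)-2\epsilon_B\frac{\beta^-}{\beta^+}\,q(x,t)\,q^*(-x,t)\,q(x,t)=0,\qquad x\in\mathbb{R},$$ where $\epsilon_B\beta^-/\beta^+$ is real.
   Context: $^*$ is complex conjugation and $^\dagger$ is the conjugate transpose. The $4\times4$ Lax matrix is $U(x,t,k)=-ik\Sigma_3+W(x,t)$ with $\Sigma_3=\mathrm{diag}(\mathbf{1}_2,-\mathbf{1}_2)$, $W=\begin{pmatrix}0&Q\\R&0\end{pmatrix}$. The reduction is called local because the $\mathbb{Z}_2$ generator acts by $(s\cdot U)(x,t,k)=\epsilon_BBU^\dagger(x,t,\sigma_s(k))B^{-1}$ without acting on $x$ or $t$. The allowed matrices $B=\mathrm{diag}(B_+,B_-)$ (with parameters $\theta\in\mathbb{R}$, $\mu=\pm1$) are: - type $\gamma=1$: $B_\pm=e^{-i\theta/2}\rho^\pm\begin{pmatrix}1&0\\0&\mu\end{pmatrix}$ with $\rho^+,\rho^-\in\mathbb{R}\setminus\{0\}$; - type $\gamma=-1$: $B_\pm=e^{-i\theta/2}\beta^\pm\begin{pmatrix}0&1\\\mu&0\end{pmatrix}$ with $\beta^+,\beta^-$ both in $\mathbb{R}\setminus\{0\}$ or both in $i\mathbb{R}\setminus\{0\}$. Data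 and solutions are assumed smooth (up to the boundary $x=0$) with sufficient decay: $Q_0,R_0$ come from Schwartz functions $q_0,r_0$ on $\mathbb{R}$ via $q^{(1)}_0(x)=q_0(x)$, $q^{(2)}_0(x)=q_0(-x)$, $r^{(1)}_0(x)=r_0(x)$, $r^{(2)}_0(x)=r_0(-x)$ for $x\ge0$; and $G_j,H_j$ are smooth and decaying in $t$. The half-line solution is identified with a full-line pair $(q,r)$ by $q^{(1)}(x,t)=q(x,t)$, $q^{(2)}(x,t)=q(-x,t)$, $r^{(1)}(x,t)=r(x,t)$, $r^{(2)}(x,t)=r(-x,t)$ for $x\ge0$. *)

(* Defs.v *)
From HB Require Import structures.
From mathcomp Require Import all_boot all_order all_algebra.
From mathcomp Require Import all_classical all_reals all_analysis.
From mathcomp.real_closed Require Import complex.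

Set Implicit Arguments.
Unset Strict Implicit.
Unset Printing Implicit Defensive.

Import Order.TTheory GRing.Theory Num.Theory.
Import numFieldNormedType.Exports.

Local Open Scope classical_set_scope.
Local Open Scope ring_scope.
Local Open Scope complex_scope.

(* Calculus on a subset [A] of the line.  The difference quotient is taken
   along points of [A] only: for [A = `[0, +oo[] this is the one-sided
   derivative at 0 and the ordinary one at x > 0, and for [A = setT] it is the
   ordinary derivative everywhere. *)
Section Calculus.
Context {R : realType}.

Definition derivable_in (A : set R) (f : R -> R) (x : R) : Prop :=
  cvg ((f y - f x) / (y - x) @[y --> within A x^']).

Definition deriv_in (A : set R) (f : R -> R) (x : R) : R :=
  lim ((f y - f x) / (y - x) @[y --> within A x^']).

Definition pdx (A : set R) (u : R -> R -> R) (x t : R) : R :=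
  deriv_in A (fun y => u y t) x.

Definition pdt (J : set R) (u : R -> R -> R) (x t : R) : R :=
  deriv_in J (fun s => u x s) t.

(* C^n on A x J, up to the boundary; continuity is joint in (x, t). *)
Fixpoint Cn (A J : set R) (n : nat) (u : R -> R -> R) : Prop :=
  {within A `*` J, continuous (fun p : R * R => u p.1 p.2)} /\
  if n is n'.+1 then
    [/\ forall x t, A x -> J t -> derivable_in A (fun y => u y t) x,
        forall x t, A x -> J t -> derivable_in J (fun s => u x s) t,
        Cn A J n' (pdx A u) &
        Cn A J n' (pdt J u)]
  else True.

(* Complex-valued functions of real variables are treated componentwise. *)
Definition smooth (A J : set R) (u : R -> R -> R[i]) : Prop :=
  forall n, Cn A J n (fun x t => complex.Re (u x t)) /\
            Cn A J n (fun x t => complex.Im (u x t)).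

Definition dx (A : set R) (u : R -> R -> R[i]) (x t : R) : R[i] :=
  pdx A (fun x t => complex.Re (u x t)) x t +i* pdx A (fun x t => complex.Im (u x t)) x t.

Definition dt (J : set R) (u : R -> R -> R[i]) (x t : R) : R[i] :=
  pdt J (fun x t => complex.Re (u x t)) x t +i* pdt J (fun x t => complex.Im (u x t)) x t.

Definition schwartz_real (f : R -> R) : Prop :=
  forall n : nat,
    (forall x, derivable (derive1n n f) x 1) /\
    (forall m : nat, exists M : R, forall x, `|x ^+ m * derive1n n f x| <= M).

Definition schwartz (f : R -> R[i]) : Prop :=
  schwartz_real (fun x => complex.Re (f x)) /\ schwartz_real (fun x => complex.Im (f x)).

Definition vanishes_at_infty (f : R -> R[i]) : Prop :=
  (complex.Re (f x) @[x --> +oo] --> (0 : R)) /\ (complex.Im (f x) @[x --> +oo] --> (0 : R)).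

Definition halfline : set R := `[0, +oo[.

(* Entrywise derivatives of matrix-valued functions on the quarter plane. *)
Definition mdx (m n : nat) (F : R -> R -> 'M[R[i]]_(m, n)) (x t : R) :
  'M[R[i]]_(m, n) := \matrix_(i, j) dx halfline (fun x t => F x t i j) x t.

Definition mdt (m n : nat) (F : R -> R -> 'M[R[i]]_(m, n)) (x t : R) :
  'M[R[i]]_(m, n) := \matrix_(i, j) dt halfline (fun x t => F x t i j) x t.

End Calculus.

Section Lax.
Context {R : realType}.
Local Notation C := R[i].

Definition dagger (n : nat) (A : 'M[C]_n) : 'M[C]_n := (map_mx (@conjc R) A)^T.

Definition mx22 (a b c d : C) : 'M[C]_2 :=
  \matrix_(i < 2, j < 2)
    if i == 0 then (if j == 0 then a else b) else (if j == 0 then c else d).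

Definition diag2 (a d : C) : 'M[C]_2 := mx22 a 0 0 d.

Definition sigma : 'M[C]_2 := mx22 0 1 1 0.

Definition Sigma3 : 'M[C]_(2 + 2) := block_mx 1%:M 0 0 (- 1%:M).

Definition laxU (Q Rm : 'M[C]_2) (k : C) : 'M[C]_(2 + 2) :=
  (- 'i%C * k) *: Sigma3 + block_mx 0 Q Rm 0.

Definition sigma_s (eps k : C) : C := - k^* / eps.

(* The action of the Z_2 generator; it leaves x and t untouched, so it is
   stated for the function of k obtained from U at a fixed (x, t). *)
Definition local_action (eps : C) (B : 'M[C]_(2 + 2)) (U : C -> 'M[C]_(2 + 2))
    (k : C) : 'M[C]_(2 + 2) :=
  eps *: (B *m dagger (U (sigma_s eps k)) *m invmx B).

Definition local_reduction (eps : C) (Bp Bm : 'M[C]_2)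
    (Q Rm : R -> R -> 'M[C]_2) : Prop :=
  forall x t, 0 <= x -> 0 <= t -> forall k,
    laxU (Q x t) (Rm x t) k =
    local_action eps (block_mx Bp 0 0 Bm) (laxU (Q x t) (Rm x t)) k.

(* e^{-i theta / 2} *)
Definition phase (theta : R) : C := cos (theta / 2) -i* sin (theta / 2).

Definition Bpos (theta : R) (mu : C) (rho : R) : 'M[C]_2 :=
  (phase theta * rho%:C) *: mx22 1 0 0 mu.

Definition Bneg (theta : R) (mu : C) (beta : C) : 'M[C]_2 :=
  (phase theta * beta) *: mx22 0 1 mu 0.

End Lax.

Section Problems.
Context {R : realType}.
Local Notation C := R[i].

(* Standing regularity of a scalar component on the quarter plane: smooth up
   to the boundary, decaying in x, with decaying boundary values. *)
Definition admissible (u : R -> R -> C) : Prop :=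
  [/\ smooth halfline halfline u,
      forall t, 0 <= t -> vanishes_at_infty (fun x => u x t),
      vanishes_at_infty (fun t => u 0 t) &
      vanishes_at_infty (fun t => dx halfline u 0 t)].

Definition akns (Q Rm : R -> R -> 'M[C]_2) : Prop :=
  forall x t, 0 < x -> 0 < t ->
    'i%C *: mdt Q x t + mdx (mdx Q) x t
      - 2 *: (Q x t *m Rm x t *m Q x t) = 0 /\
    - 'i%C *: mdt Rm x t + mdx (mdx Rm) x t
      - 2 *: (Rm x t *m Q x t *m Rm x t) = 0.

(* [F] is either Q or R: Dirichlet data F(0, t) and Neumann data F_x(0, t). *)
Definition boundary_condition (F : R -> R -> 'M[C]_2) : Prop :=
  forall t, 0 <= t ->
    F 0 t - sigma *m F 0 t *m sigma = 0 /\
    mdx F 0 t + sigma *m mdx F 0 t *m sigma = 0.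

Definition half_line_ibvp (Q0 R0 : R -> 'M[C]_2) (Q Rm : R -> R -> 'M[C]_2) :
  Prop :=
  [/\ akns Q Rm,
      forall x, 0 <= x -> Q x 0 = Q0 x /\ Rm x 0 = R0 x,
      boundary_condition Q &
      boundary_condition Rm].

(* [q] is the full-line function folded into the pair (q1, q2). *)
Definition unfolds (q1 q2 q : R -> R -> C) : Prop :=
  forall x t, 0 <= x -> 0 <= t -> q x t = q1 x t /\ q (- x) t = q2 x t.

Definition nls (c : C) (q : R -> R -> C) : Prop :=
  forall x t, 0 < t ->
    'i%C * dt halfline q x t + dx setT (dx setT q) x t
      - 2 * c * `|q x t| ^+ 2 * q x t = 0.

Definition nonlocal_nls (c : C) (q : R -> R -> C) : Prop :=
  forall x t, 0 < t ->
    'i%C * dt halfline q x t + dx setT (dx setT q) x t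
      - 2 * c * (q x t * (q (- x) t)^* * q x t) = 0.

End Problems.

(* Main.v *)
(** Folding a function [q] on the line into the pair [(q(x), q(-x))], [x >= 0],
turns the line equation into the half-line system; the reduction makes [r1, r2]
real multiples of the conjugates of [q1, q2] (type 1) or of [q2, q1] (type -1).
The substantial point is that gluing a solution of the half-line problem gives
a smooth function across [x = 0] although the boundary conditions only match
[q] and [q_x] there.  The equation, valid up to the boundary by continuity,
expresses [q_xx] through [q_t] and cubic terms; so, mixed partials being
symmetric, every derivative of the pair lies in the differential algebra
generated by [q] and [q_x] under [d/dt] and the reflection [x |-> -x], and all
elements of that algebra match at [x = 0]. *)

(* Both types follow one argument, with a boolean [b] saying whether conjugation by [B] exchanges
   the diagonal entries. The phase cancels between [B_-] and the inverse of [B_+], so the reduction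
   reads [r = c conj p] with [c] real, [p] being [q] at [x] or at [- x]. Realness of [c] serves
   twice: the [Q] block of the reduction follows from the [R] block, and the equations and boundary
   conditions for [R] are conjugates of those for [Q]. A folded pair [(u, v)] stands for [u x] on
   the right and [v (- x)] on the left, so d/dx sends it to [(u_x, - v_x)]; the boundary conditions
   thus say that [q] and [q_x], as folded pairs, match at 0. The equations hold only in the open
   quadrant, while the recursion on derivatives and the symmetry of mixed partials are needed on the
   closed one, corner included: both get there by continuity. Moreover derivatives are values of a
   total [lim], so two functions are often known to agree on the quadrant only; hence the
   extensionality principles [Cn_ext] and [gen_ext]. *)
Require Import Defs.
From HB Require Import structures.
From mathcomp Require Import all_boot all_order all_algebra.
From mathcomp Require Import all_classical all_reals all_analysis.
From mathcomp.real_closed Require Import complex.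
From mathcomp Require Import ring lra.

Set Implicit Arguments.
Unset Strict Implicit.
Unset Printing Implicit Defensive.

Import Order.TTheory GRing.Theory Num.Theory.
Import numFieldNormedType.Exports.

Local Open Scope classical_set_scope.
Local Open Scope ring_scope.
Local Open Scope complex_scope.

(** * Derivatives along a subset of the line *)

Section HasDeriv.
Context {R : realType}.
Implicit Types (A B : set R) (f g : R -> R) (x l m : R).

(** A relation rather than a function: existence and value are carried together, so the rules of
    calculus compose without uniqueness. The value of [deriv_in] is read off at the end, by
    [has_deriv_unique]. *)
Definition has_deriv A f x l : Prop :=
  (f y - f x) / (y - x) @[y --> within A x^'] --> l.

(** No point of [A] is isolated in [A], which is what makes limits of difference quotients
    unique. *)
Definition limit_set A : Prop := forall x, A x -> ProperFilter (within A x^').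

#[local] Instance within_dnbhs_filter A x : Filter (within A x^').
Proof. by apply: within_filter; exact: dnbhs_filter. Qed.

Lemma cvg_near_eq (T : Type) (F : set_system T) (f g : T -> R) l : Filter F ->
  (\forall y \near F, f y = g y) -> f y @[y --> F] --> l -> g y @[y --> F] --> l.
Proof. by move=> FF fg; apply: cvg_trans; apply: near_eq_cvg. Qed.

Lemma has_deriv_deriv_in A f x :
  derivable_in A f x -> has_deriv A f x (deriv_in A f x).
Proof. by []. Qed.

Lemma has_deriv_derivable A f x l : has_deriv A f x l -> derivable_in A f x.
Proof. by move=> h; apply/cvg_ex; exists l. Qed.

Lemma has_deriv_unique A f x l : limit_set A -> A x ->
  has_deriv A f x l -> deriv_in A f x = l.
Proof.
by move=> /[apply] PA h; apply: cvg_lim h; exact: norm_hausdorff.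
Qed.

Lemma near_within_dnbhs A x : \forall y \near within A x^', A y /\ y != x.
Proof.
have := @nbhs_dnbhs_neq _ x; rewrite /prop_near1 /nbhs /= /within /=.
by apply: filterS.
Qed.

Lemma has_deriv_ext A f g x l : A x -> (forall y, A y -> f y = g y) ->
  has_deriv A f x l -> has_deriv A g x l.
Proof.
move=> Ax fg; rewrite /has_deriv (fg _ Ax); apply: cvg_near_eq.
by apply: filterS (near_within_dnbhs A x) => y [Ay _]; rewrite fg.
Qed.

Lemma has_deriv_cts A f x l : has_deriv A f x l -> f y @[y --> within A x^'] --> f x.
Proof.
move=> h.
have yx : y @[y --> within A x^'] --> x.
  by move=> P nP; have := nbhs_dnbhs nP; rewrite /within /=; apply: filterS.
have : (f y - f x) / (y - x) * (y - x) + f x @[y --> within A x^']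
    --> l * (x - x) + f x.
  apply: cvgD; last exact: cvg_cst.
  by apply: cvgM h _; apply: cvgB yx _; exact: cvg_cst.
rewrite subrr mulr0 add0r; apply: cvg_near_eq.
apply: filterS (near_within_dnbhs A x) => y [_ yneqx].
by rewrite divfK ?subrK// subr_eq0.
Qed.

Lemma has_derivD A f g x l m : has_deriv A f x l -> has_deriv A g x m ->
  has_deriv A (fun y => f y + g y) x (l + m).
Proof.
move=> hf hg; apply: cvg_near_eq (cvgD hf hg).
by apply: nearW => y /=; rewrite -mulrDl; congr (_ / _); ring.
Qed.

Lemma has_derivM A f g x l m : has_deriv A f x l -> has_deriv A g x m ->
  has_deriv A (fun y => f y * g y) x (l * g x + f x * m).
Proof.
move=> hf hg.
apply: cvg_near_eq (cvgD (cvgM hf (cvg_cst (g x))) (cvgM (has_deriv_cts hf) hg)).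
apply: nearW => y /=.
by rewrite mulrAC mulrA -mulrDl; congr (_ / _); ring.
Qed.

Lemma has_deriv_cst A k x : has_deriv A (fun=> k) x 0.
Proof.
rewrite /has_deriv; under eq_fun do rewrite subrr mul0r; exact: cvg_cst.
Qed.

Lemma has_derivZ A k f x l : has_deriv A f x l -> has_deriv A (fun y => k * f y) x (k * l).
Proof. by move=> /(has_derivM (has_deriv_cst A k x)); rewrite mul0r add0r. Qed.

Lemma has_derivN A f x l : has_deriv A f x l -> has_deriv A (fun y => - f y) x (- l).
Proof.
move=> /(has_derivZ (k := -1)); rewrite mulN1r.
by under eq_fun do rewrite mulN1r.
Qed.

Lemma has_deriv_sub A B f x l : A `<=` B -> has_deriv B f x l -> has_deriv A f x l.
Proof.
by move=> AB; apply: cvg_trans; apply: cvg_app; exact: within_subset.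
Qed.

Lemma has_deriv_nbhs A f x l : nbhs x A -> has_deriv A f x l -> has_deriv setT f x l.
Proof.
move=> nA; apply: cvg_trans; apply: cvg_app => P; rewrite /within /= /dnbhs /within /=.
by apply: filterS2 nA => y Ay + yx _; exact.
Qed.

(** Meant for [x = 0], where two one-sided derivatives with the same value give a two-sided one. *)
Lemma has_deriv_setU A B f x l :
  has_deriv A f x l -> has_deriv B f x l -> has_deriv (A `|` B) f x l.
Proof.
move=> hA hB P nP; have := hB P nP; have := hA P nP.
rewrite /= /nbhs /= /within /= /dnbhs /within /=.
by apply: (@filterS2 _ (nbhs x)) => y hAy hBy yx [Ay|By]; [exact: hAy|exact: hBy].
Qed.

Lemma has_deriv_opp A f x l :
  has_deriv A f x l -> has_deriv [set y | A (- y)] (fun y => f (- y)) (- x) (- l).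
Proof.
move=> h.
have c : - y @[y --> within [set y | A (- y)] (- x)^'] --> within A x^'.
  move=> P /=; rewrite /nbhs /= /within /= /dnbhs /within /= => nP.
  have : - y @[y --> - x] --> x by rewrite -{2}(opprK x); exact: opp_continuous.
  move=> /(_ _ nP); apply: (@filterS _ (nbhs (- x))) => y /= + yx; apply.
  by rewrite eqr_oppLR.
apply: cvg_near_eq (cvgN (cvg_comp _ _ c h)).
apply: nearW => y /=; rewrite opprK -mulrN -invrN; congr (_ * _^-1); ring.
Qed.

(** Bridge to the library's notion of derivative, through the shift [y |-> y + x]; it gives access
    to the mean value theorem. *)
Lemma has_deriv_is_derive f x l : has_deriv setT f x l -> is_derive x 1 f l.
Proof.
rewrite /has_deriv withinET => h.
have c : y + x @[y --> 0^'] --> x^'.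
  move=> P /=; rewrite /nbhs /= /dnbhs /within /= => nP.
  have : y + x @[y --> (0 : R)] --> x.
    by rewrite -{2}(add0r x); apply: cvgD; [exact: cvg_id|exact: cvg_cst].
  move=> /(_ _ nP); apply: (@filterS _ (nbhs (0 : R))) => y /= + yx; apply.
  by rewrite -subr_eq0 addrK.
have h' : (y^-1 *: ((f \o shift x) (y *: 1) - f x)) @[y --> 0^'] --> l.
  apply: cvg_near_eq (cvg_comp _ _ c h).
  apply: nearW => y /=; rewrite addrK mulrC /=.
  by rewrite /GRing.scale /= mulr1.
apply: DeriveDef; first by apply/cvg_ex; exists l.
by apply: cvg_lim h'; exact: norm_hausdorff.
Qed.

Lemma limit_set_setT : limit_set setT.
Proof. by move=> x _; rewrite withinET; exact: Proper_dnbhs_numFieldType. Qed.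

Lemma limit_set_halfline : limit_set (halfline : set R).
Proof.
move=> x; rewrite /halfline /= in_itv /= andbT => x0; apply: Build_ProperFilter_ex.
move=> P; rewrite /within /= /dnbhs /= /within /= => -[e /= e0 h].
exists (x + e / 2); apply: h => /=.
- by rewrite /ball_ /= opprD addrA subrr sub0r normrN gtr0_norm; lra.
- by rewrite gt_eqF//; lra.
- by rewrite in_itv /= andbT; lra.
Qed.

End HasDeriv.

(** * Functions of class C^n on a product *)

Section Cn_theory.
Context {R : realType}.
Variables A J : set R.
Hypotheses (LA : limit_set A) (LJ : limit_set J).
Implicit Types (u v : R -> R -> R).

Lemma pdxE u (x t l : R) : A x -> has_deriv A (u^~ t) x l -> pdx A u x t = l.
Proof. by move=> Ax; exact: has_deriv_unique. Qed.

Lemma pdtE u (x t l : R) : J t -> has_deriv J (u x) t l -> pdt J u x t = l.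
Proof. by move=> Jt; exact: has_deriv_unique. Qed.

Lemma Cn_continuous n u : Cn A J n u ->
  {within A `*` J, continuous (fun p : R * R => u p.1 p.2)}.
Proof. by case: n => [|n] []. Qed.

Lemma CnS_dx n u (x t : R) : Cn A J n.+1 u -> A x -> J t -> has_deriv A (u^~ t) x (pdx A u x t).
Proof. by move=> [_ [h _ _ _]] Ax Jt; exact: has_deriv_deriv_in (h _ _ Ax Jt). Qed.

Lemma CnS_dt n u (x t : R) : Cn A J n.+1 u -> A x -> J t -> has_deriv J (u x) t (pdt J u x t).
Proof. by move=> [_ [_ h _ _]] Ax Jt; exact: has_deriv_deriv_in (h _ _ Ax Jt). Qed.

Lemma Cn_pdx n u : Cn A J n.+1 u -> Cn A J n (pdx A u).
Proof. by move=> [_ []]. Qed.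

Lemma Cn_pdt n u : Cn A J n.+1 u -> Cn A J n (pdt J u).
Proof. by move=> [_ []]. Qed.

Lemma CnS n u : Cn A J n.+1 u -> Cn A J n u.
Proof.
elim: n u => [|n IH] u; first by move=> [].
move=> [cu [hx ht hdx hdt]]; split; first exact: cu.
exact: (And4 hx ht (IH _ hdx) (IH _ hdt)).
Qed.

Lemma within_continuous_ext (S : set R) (T : set R) u v :
  (forall x t, S x -> T t -> u x t = v x t) ->
  {within S `*` T, continuous (fun p : R * R => u p.1 p.2)} ->
  {within S `*` T, continuous (fun p : R * R => v p.1 p.2)}.
Proof.
move=> uv; apply: subspace_eq_continuous => -[x t] /=.
by rewrite inE => -[/= Sx Tt]; exact: uv.
Qed.

(** The actual [pdx A u] is only known to agree with [ux] on [A] times [J]. Quantifying over all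
    such [v] avoids extensionality of [Cn], whose own proof goes through this lemma. *)
Lemma Cn_dx_intro n u (ux ut : R -> R -> R) :
  {within A `*` J, continuous (fun p : R * R => u p.1 p.2)} ->
  (forall x t, A x -> J t -> has_deriv A (u^~ t) x (ux x t)) ->
  (forall x t, A x -> J t -> has_deriv J (u x) t (ut x t)) ->
  (forall v, (forall x t, A x -> J t -> ux x t = v x t) -> Cn A J n v) ->
  (forall v, (forall x t, A x -> J t -> ut x t = v x t) -> Cn A J n v) ->
  Cn A J n.+1 u.
Proof.
move=> cu hx ht cx ct; split=> //; split.
- by move=> x t Ax Jt; exact: has_deriv_derivable (hx x t Ax Jt).
- by move=> x t Ax Jt; exact: has_deriv_derivable (ht x t Ax Jt).
- by apply: cx => x t Ax Jt; rewrite (pdxE Ax (hx x t Ax Jt)).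
- by apply: ct => x t Ax Jt; rewrite (pdtE Jt (ht x t Ax Jt)).
Qed.

Lemma Cn_ext n u v : (forall x t, A x -> J t -> u x t = v x t) ->
  Cn A J n u -> Cn A J n v.
Proof.
elim: n u v => [|n IH] u v uv cu.
  by split=> //; exact: within_continuous_ext uv (Cn_continuous cu).
have [cux cut] := (Cn_pdx cu, Cn_pdt cu).
apply: (@Cn_dx_intro n v (pdx A u) (pdt J u)).
- exact: within_continuous_ext uv (Cn_continuous cu).
- move=> x t Ax Jt; apply: (has_deriv_ext (f := u^~ t)) => //; last exact: CnS_dx cu _ _.
  by move=> y Ay; exact: uv.
- move=> x t Ax Jt; apply: (has_deriv_ext (f := u x)) => //; last exact: CnS_dt cu _ _.
  by move=> y Jy; exact: uv.
- by move=> w hw; exact: IH cux.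
- by move=> w hw; exact: IH cut.
Qed.

Lemma Cn_intro n u (ux ut : R -> R -> R) :
  {within A `*` J, continuous (fun p : R * R => u p.1 p.2)} ->
  (forall x t, A x -> J t -> has_deriv A (u^~ t) x (ux x t)) ->
  (forall x t, A x -> J t -> has_deriv J (u x) t (ut x t)) ->
  Cn A J n ux -> Cn A J n ut -> Cn A J n.+1 u.
Proof.
by move=> cu hx ht cx ct; apply: (Cn_dx_intro cu hx ht) => v /Cn_ext; exact.
Qed.

Lemma Cn_cst n (k : R) : Cn A J n (fun _ _ => k).
Proof.
elim: n k => [|n IH] k; first by split=> // p; exact: cvg_cst.
apply: (Cn_intro (ux := fun _ _ => 0) (ut := fun _ _ => 0)) => //.
- by move=> p; exact: cvg_cst.
- by move=> x t _ _; exact: has_deriv_cst.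
- by move=> x t _ _; exact: has_deriv_cst.
Qed.

Lemma CnD n u v : Cn A J n u -> Cn A J n v -> Cn A J n (fun x t => u x t + v x t).
Proof.
have cD w z m : Cn A J m w -> Cn A J m z ->
    {within A `*` J, continuous (fun p : R * R => w p.1 p.2 + z p.1 p.2)}.
  move=> /Cn_continuous cw /Cn_continuous cz p.
  by apply: cvgD; [exact: cw|exact: cz].
elim: n u v => [|n IH] u v cu cv; first by split=> //; exact: cD cu cv.
have [cux cut] := (Cn_pdx cu, Cn_pdt cu); have [cvx cvt] := (Cn_pdx cv, Cn_pdt cv).
apply: (Cn_intro (cD _ _ _ cu cv)) (IH _ _ cux cvx) (IH _ _ cut cvt).
- by move=> x t Ax Jt; apply: has_derivD; [exact: CnS_dx cu _ _|exact: CnS_dx cv _ _].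
- by move=> x t Ax Jt; apply: has_derivD; [exact: CnS_dt cu _ _|exact: CnS_dt cv _ _].
Qed.

Lemma CnM n u v : Cn A J n u -> Cn A J n v -> Cn A J n (fun x t => u x t * v x t).
Proof.
have cM w z m : Cn A J m w -> Cn A J m z ->
    {within A `*` J, continuous (fun p : R * R => w p.1 p.2 * z p.1 p.2)}.
  move=> /Cn_continuous cw /Cn_continuous cz p.
  by apply: cvgM; [exact: cw|exact: cz].
elim: n u v => [|n IH] u v cu cv; first by split=> //; exact: cM cu cv.
have [cux cut] := (Cn_pdx cu, Cn_pdt cu); have [cvx cvt] := (Cn_pdx cv, Cn_pdt cv).
(* Leibniz' rule multiplies a derivative by an underived factor, which must first be lowered to
   order [n]. *)
have cu' := CnS cu; have cv' := CnS cv.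
apply: (Cn_intro (cM _ _ _ cu cv) _ _
  (CnD (IH _ _ cux cv') (IH _ _ cu' cvx)) (CnD (IH _ _ cut cv') (IH _ _ cu' cvt))).
- by move=> x t Ax Jt; apply: has_derivM; [exact: CnS_dx cu _ _|exact: CnS_dx cv _ _].
- by move=> x t Ax Jt; apply: has_derivM; [exact: CnS_dt cu _ _|exact: CnS_dt cv _ _].
Qed.

End Cn_theory.

(** * Gluing two functions on the quarter plane *)

Section Glue.
Context {R : realType}.
Local Notation H := (halfline : set R).

Implicit Types (u v : R -> R -> R).

Lemma halflineE (x : R) : H x = (0 <= x) :> Prop.
Proof. by rewrite /halfline /= in_itv /= andbT. Qed.

Lemma nbhs_halfline (x : R) : 0 < x -> nbhs x H.
Proof.
by move=> x0; near=> y; rewrite halflineE ltW//; near: y; exact: lt_nbhsr.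
Unshelve. all: by end_near. Qed.

Lemma within_setX_continuousP (A J : set R) u :
  {within A `*` J, continuous (fun p : R * R => u p.1 p.2)} <->
  forall x t, A x -> J t -> forall e, 0 < e -> exists2 d, 0 < d &
    forall y s, A y -> J s -> `|y - x| < d -> `|s - t| < d -> `|u y s - u x t| < e.
Proof.
rewrite subspace_continuousP; split=> [h x t Ax Jt e e0|h [x t] [/= Ax Jt]].
  have /cvgrPdist_lt /(_ e e0) := h (x, t) (conj Ax Jt).
  rewrite near_withinE => /nbhs_ballP[d /= d0 hd].
  exists d => // y s Ay Js yx st; rewrite distrC; apply: (hd (y, s)) => //.
  by split; rewrite /ball /= distrC.
apply/cvgrPdist_lt => e e0; have [d d0 hd] := h x t Ax Jt e e0.
rewrite near_withinE; apply/nbhs_ballP; exists d => //.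
move=> [y s] [/= yx st] [/= Ay Js]; rewrite distrC; apply: hd => //.
- by rewrite distrC.
- by rewrite distrC.
Qed.

(** Both points tend to [(x, t)] as [d] shrinks, so continuity gives equality in the limit. The
    points may differ because mean value theorems for [u] and for [v] yield unrelated intermediate
    points; they lie to the upper right, hence inside the quadrant even when [(x, t)] is on its
    boundary. *)
Lemma eq_quadrant u v :
  {within H `*` H, continuous (fun p : R * R => u p.1 p.2)} ->
  {within H `*` H, continuous (fun p : R * R => v p.1 p.2)} ->
  (forall d x t, 0 <= x -> 0 <= t -> 0 < d -> exists y s z r,
    [/\ x < y < x + d, t < s < t + d, x < z < x + d, t < r < t + d & u y s = v z r]) ->
  forall x t, 0 <= x -> 0 <= t -> u x t = v x t.
Proof.
move=> /within_setX_continuousP cu /within_setX_continuousP cv h x t x0 t0.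
apply/eqP; rewrite -subr_eq0; apply: contraT; rewrite -normr_gt0 => n0.
(* Half the supposed gap: the two continuity estimates then add up to less than the gap itself. *)
have e0 : 0 < `|u x t - v x t| / 2 by rewrite divr_gt0.
have [Hx Ht] : H x /\ H t by rewrite !halflineE.
have [d1 d10 h1] := cu x t Hx Ht _ e0; have [d2 d20 h2] := cv x t Hx Ht _ e0.
have d0 : 0 < Num.min d1 d2 by rewrite lt_min d10.
have [y [s [z [r [xy ts xz tr uv]]]]] := h _ _ _ x0 t0 d0.
have lt_d w w' d : w < w' < w + Num.min d1 d2 -> (d = d1) \/ (d = d2) -> `|w' - w| < d.
  move=> /andP[ww' w'd] hd; rewrite gtr0_norm ?subr_gt0// ltrBlDl (lt_le_trans w'd)//.
  by rewrite lerD2l; case: hd => ->; rewrite ge_min lexx ?orbT.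
have Hgt w w' d : 0 <= w -> w < w' < w + d -> H w'.
  by rewrite halflineE => w0 /andP[/ltW ww' _]; exact: le_trans ww'.
have := h1 y s (Hgt _ _ _ x0 xy) (Hgt _ _ _ t0 ts) (lt_d _ _ _ xy (or_introl erefl))
  (lt_d _ _ _ ts (or_introl erefl)).
have := h2 z r (Hgt _ _ _ x0 xz) (Hgt _ _ _ t0 tr) (lt_d _ _ _ xz (or_intror erefl))
  (lt_d _ _ _ tr (or_intror erefl)).
rewrite uv => hv hu; have := ltrD hu hv; rewrite -splitr.
have := ler_distD (v z r) (u x t) (v x t).
by rewrite (distrC (u x t) (v z r)) => h3 h4; move: (le_lt_trans h3 h4); rewrite ltxx.
Qed.

Lemma eq_quadrant_interior u v :
  {within H `*` H, continuous (fun p : R * R => u p.1 p.2)} ->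
  {within H `*` H, continuous (fun p : R * R => v p.1 p.2)} ->
  (forall x t, 0 < x -> 0 < t -> u x t = v x t) ->
  forall x t, 0 <= x -> 0 <= t -> u x t = v x t.
Proof.
move=> cu cv uv; apply: (eq_quadrant cu cv) => d x t x0 t0 d0.
exists (x + d / 2), (t + d / 2), (x + d / 2), (t + d / 2).
by split; [..|apply: uv]; lra.
Qed.

(** Works from [a = 0]: strictly between [a] and [b] the derivative along the half-line is the
    ordinary one, and at the end points only continuity is required. *)
Lemma halfline_MVT (f df : R -> R) (a b : R) : 0 <= a -> a < b ->
  (forall y, 0 <= y -> has_deriv H f y (df y)) ->
  exists2 c, a < c < b & f b - f a = df c * (b - a).
Proof.
move=> a0 ab hf.
have [||c] := @MVT R f df a b ab; last by rewrite in_itv /=; exists c.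
- move=> y; rewrite in_itv /= => /andP[ay _].
  have y0 : 0 < y by exact: le_lt_trans ay.
  apply: has_deriv_is_derive; apply: has_deriv_nbhs (nbhs_halfline y0) _.
  exact: hf (ltW y0).
- apply/subspace_continuousP => y; rewrite /= in_itv /= => /andP[ay _].
  have cf := has_deriv_cts (hf y (le_trans a0 ay)).
  move=> P nP; have := cf _ nP; rewrite /nbhs /= /within /= /dnbhs /within /=.
  apply: (@filterS _ (nbhs y)) => z /= hz; rewrite in_itv /= => /andP[az _].
  have [->|zy] := eqVneq z y; first exact: nbhs_singleton nP.
  by apply: hz => //; rewrite halflineE (le_trans a0).
Qed.

(* Both mixed partials equal the same second difference of [u] over a small
   square, at points of that square lying to the upper right of [(x, t)]; this
   works up to the boundary. *)
Lemma pdxC u : Cn H H 2 u ->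
  forall x t, 0 <= x -> 0 <= t -> pdx H (pdt H u) x t = pdt H (pdx H u) x t.
Proof.
move=> cu; have [cux cut] := (Cn_pdx cu, Cn_pdt cu).
have [cuxt cutx] := (Cn_pdt cux, Cn_pdx cut).
apply: eq_quadrant; [exact: Cn_continuous cutx|exact: Cn_continuous cuxt|].
move=> d x t x0 t0 d0.
have [e e0 ed] : exists2 e, 0 < e & e < d by exists (d / 2); lra.
have lt_d w w' : w < w' < w + e -> w < w' < w + d.
  by move=> /andP[-> /lt_trans]; apply; rewrite ltrD2l.
have [xe te] : 0 <= x + e /\ 0 <= t + e by lra.
have [xle tle] : x < x + e /\ t < t + e by lra.
have [|z hz Ez] := @halfline_MVT (fun y => u y (t + e) - u y t)
    (fun y => pdx H u y (t + e) - pdx H u y t) x (x + e) x0 xle.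
  move=> y y0; apply: has_derivD; last apply: has_derivN.
  - by apply: CnS_dx cu _ _; rewrite halflineE.
  - by apply: CnS_dx cu _ _; rewrite halflineE.
have z0 : 0 <= z by lra.
have [|r hr Er] := @halfline_MVT (pdx H u z) (pdt H (pdx H u) z) t (t + e) t0 tle.
  by move=> s s0; apply: CnS_dt cux _ _; rewrite halflineE.
have [|s hs Es] := @halfline_MVT (fun s => u (x + e) s - u x s)
    (fun s => pdt H u (x + e) s - pdt H u x s) t (t + e) t0 tle.
  move=> s s0; apply: has_derivD; last apply: has_derivN.
  - by apply: CnS_dt cu _ _; rewrite halflineE.
  - by apply: CnS_dt cu _ _; rewrite halflineE.
have s0 : 0 <= s by lra.
have [|y hy Ey] := @halfline_MVT (pdt H u ^~ s) (pdx H (pdt H u) ^~ s) x (x + e) x0 xle.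
  by move=> y y0; apply: CnS_dx cut _ _; rewrite halflineE.
exists y, s, z, r; split; [exact: lt_d..|].
move: Ez Es; rewrite Er Ey => Ez Es.
have ee : (x + e - x) * (t + e - t) != 0 by rewrite mulf_neq0// gt_eqF//; lra.
by apply: (mulIf ee); rewrite mulrA -Es [RHS]mulrA [RHS]mulrAC -Ez; ring.
Qed.

(** The value at 0 is taken from [u]; the choice is harmless once [u] and [v] match there. *)
Definition glue u v (x t : R) : R := if 0 <= x then u x t else v (- x) t.

Lemma glue_continuous u v :
  {within H `*` H, continuous (fun p : R * R => u p.1 p.2)} ->
  {within H `*` H, continuous (fun p : R * R => v p.1 p.2)} ->
  (forall t, 0 <= t -> u 0 t = v 0 t) ->
  {within setT `*` H, continuous (fun p : R * R => glue u v p.1 p.2)}.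
Proof.
move=> /within_setX_continuousP cu /within_setX_continuousP cv uv0.
apply/within_setX_continuousP => x t _ Ht e e0; have t0 := Ht; rewrite halflineE in t0.
have [x_lt0|x_gt0|x0] := ltgtP x 0.
- have Hx : H (- x) by rewrite halflineE; lra.
  (* The bound [- x] on the radius keeps [y] on the negative side, so a single branch of [glue] is
     involved. *)
  have [d d0 hd] := cv _ _ Hx Ht _ e0; exists (Num.min d (- x)).
    by rewrite lt_min d0; lra.
  move=> y s _ Hs; rewrite !lt_min => /andP[yx yx'] /andP[st _].
  have y0 : y < 0 by have := ler_norm (y - x); lra.
  rewrite /glue !leNgt x_lt0 y0 /=; apply: hd => //; first by rewrite halflineE; lra.
  by rewrite -opprD normrN.
- have Hx : H x by rewrite halflineE ltW.
  have [d d0 hd] := cu _ _ Hx Ht _ e0; exists (Num.min d x).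
    by rewrite lt_min d0.
  move=> y s _ Hs; rewrite !lt_min => /andP[yx yx'] /andP[st _].
  have y0 : 0 <= y by have := ler_norm (x - y); rewrite distrC; lra.
  by rewrite /glue y0 (ltW x_gt0); apply: hd => //; rewrite halflineE.
- have H0 : H 0 by rewrite halflineE.
  have [d d0 hd] := cu _ _ H0 Ht _ e0; have [d' d'0 hd'] := cv _ _ H0 Ht _ e0.
  exists (Num.min d d'); first by rewrite lt_min d0.
  move=> y s _ Hs; rewrite x0 subr0 !lt_min => /andP[yd yd'] /andP[sd sd'].
  rewrite /glue lexx; have [y0|y0] := leP 0 y.
    by apply: hd; rewrite ?subr0 // halflineE.
  by rewrite uv0//; apply: hd'; rewrite ?subr0 ?normrN // halflineE; lra.
Qed.

(** On the left the function is [g] after a reflection, which flips the sign of the derivative: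
    slope [l] corresponds to slope [- l] of [g]. At 0 both half-lines contribute, with the same
    [l]. *)
Lemma has_deriv_glue (f g : R -> R) (x l : R) : f 0 = g 0 ->
  (0 <= x -> has_deriv H f x l) -> (x <= 0 -> has_deriv H g (- x) (- l)) ->
  has_deriv setT (fun y => if 0 <= y then f y else g (- y)) x l.
Proof.
move=> fg0 hf hg.
set h := fun y => _; set N := [set y | H (- y)].
have hH : 0 <= x -> has_deriv H h x l.
  move=> x0; apply: has_deriv_ext (hf x0); rewrite ?halflineE//.
  by move=> y; rewrite halflineE /h => ->.
have hN : x <= 0 -> has_deriv N h x l.
  move=> x0; have := has_deriv_opp (hg x0); rewrite !opprK.
  apply: has_deriv_ext; rewrite /N /= ?halflineE ?oppr_ge0//.
  move=> y; rewrite halflineE oppr_ge0 /h => y0.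
  by have [y0'|//] := leP 0 y; rewrite (le_anti (introT andP (conj y0 y0'))) oppr0.
have [x_lt0|x_gt0|x0] := ltgtP x 0.
- apply: has_deriv_nbhs (hN (ltW x_lt0)).
  near=> y; rewrite /N /= halflineE oppr_ge0 ltW//; near: y; exact: lt_nbhsl.
- exact: has_deriv_nbhs (nbhs_halfline x_gt0) (hH (ltW x_gt0)).
- have -> : setT = H `|` N.
    apply/seteqP; split=> y // _; rewrite /N /setU /= !halflineE oppr_ge0.
    by case: (leP 0 y) => [|/ltW]; [left|right].
  by apply: has_deriv_setU; [apply: hH|apply: hN]; rewrite x0.
Unshelve. all: by end_near. Qed.

Lemma pdx_glue u v (x t : R) : Cn H H 1 u -> Cn H H 1 v -> 0 <= t ->
  u 0 t = v 0 t -> pdx H u 0 t = - pdx H v 0 t ->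
  has_deriv setT (glue u v ^~ t) x (glue (pdx H u) (fun x t => - pdx H v x t) x t).
Proof.
move=> cu cv t0 uv0 duv0; apply: (@has_deriv_glue (u^~ t) (v^~ t)) => // x0.
  by rewrite /glue x0; apply: CnS_dx cu _ _; rewrite halflineE.
(* At [x = 0] the glued derivative takes the branch of [u], while the slope of [v] is required; the
   matching of derivatives converts one into the other. *)
rewrite /glue; case: ifPn => [x0'|_].
  have -> : x = 0 by apply: le_anti; rewrite x0 x0'.
  by rewrite duv0 oppr0 opprK; apply: CnS_dx cv _ _; rewrite halflineE.
by rewrite opprK; apply: CnS_dx cv _ _; rewrite halflineE ?oppr_ge0.
Qed.

Lemma pdt_glue u v (x t : R) : Cn H H 1 u -> Cn H H 1 v -> 0 <= t ->
  has_deriv H (glue u v x) t (glue (pdt H u) (pdt H v) x t).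
Proof.
move=> cu cv t0; rewrite /glue; case: leP => x0.
  by apply: CnS_dt cu _ _; rewrite halflineE.
by apply: CnS_dt cv _ _; rewrite halflineE ?oppr_ge0// ltW.
Qed.

End Glue.

(** * Regularity across the boundary *)

Section Folded.
Context {R : realType}.
Local Notation H := (halfline : set R).
Let LH := @limit_set_halfline R.
Implicit Types (u v : R -> R -> R).

Definition smooth_quadrant u := forall n, Cn H H n u.

Lemma smooth_quadrant_dx u : smooth_quadrant u -> smooth_quadrant (pdx H u).
Proof. by move=> su n; exact: Cn_pdx (su n.+1). Qed.

Lemma smooth_quadrant_dt u : smooth_quadrant u -> smooth_quadrant (pdt H u).
Proof. by move=> su n; exact: Cn_pdt (su n.+1). Qed.

Lemma pdx_deriv u (x t : R) : smooth_quadrant u -> 0 <= x -> 0 <= t ->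
  has_deriv H (u^~ t) x (pdx H u x t).
Proof. by move=> su x0 t0; apply: CnS_dx (su 1%N) _ _; rewrite halflineE. Qed.

Lemma pdt_deriv u (x t : R) : smooth_quadrant u -> 0 <= x -> 0 <= t ->
  has_deriv H (u x) t (pdt H u x t).
Proof. by move=> su x0 t0; apply: CnS_dt (su 1%N) _ _; rewrite halflineE. Qed.

Lemma eq_pdx u v (x t : R) : smooth_quadrant u -> 0 <= x -> 0 <= t ->
  (forall y, 0 <= y -> u y t = v y t) -> pdx H v x t = pdx H u x t.
Proof.
move=> su x0 t0 uv; have Hx : H x by rewrite halflineE.
apply: pdxE => //; apply: has_deriv_ext (pdx_deriv su x0 t0) => // y.
by rewrite halflineE; exact: uv.
Qed.

Lemma eq_pdt u v (x t : R) : smooth_quadrant u -> 0 <= x -> 0 <= t ->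
  (forall s, 0 <= s -> u x s = v x s) -> pdt H v x t = pdt H u x t.
Proof.
move=> su x0 t0 uv; have Ht : H t by rewrite halflineE.
apply: pdtE => //; apply: has_deriv_ext (pdt_deriv su x0 t0) => // y.
by rewrite halflineE; exact: uv.
Qed.

Lemma eq_smooth_quadrant u v : (forall x t, 0 <= x -> 0 <= t -> u x t = v x t) ->
  smooth_quadrant u -> smooth_quadrant v.
Proof.
move=> uv su n; apply: Cn_ext (su n) => // x t.
by rewrite !halflineE; exact: uv.
Qed.

Lemma smooth_quadrantZ k u : smooth_quadrant u -> smooth_quadrant (fun x t => k * u x t).
Proof. by move=> su n; apply: CnM => //; exact: Cn_cst. Qed.

Section Gen.
Variable base : (R -> R -> R) -> (R -> R -> R) -> Prop.

(* A function on the line is folded into the pair of its restrictions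
   [x |-> u x] and [x |-> u (- x)]; [gen] is the differential algebra
   generated by [base] under d/dt and the reflection [x |-> -x]. *)
Inductive gen : (R -> R -> R) -> (R -> R -> R) -> Prop :=
| gen_base u v of base u v : gen u v
| gen_ext u v u' v' of gen u v &
    (forall x t, 0 <= x -> 0 <= t -> u x t = u' x t) &
    (forall x t, 0 <= x -> 0 <= t -> v x t = v' x t) : gen u' v'
| gen_cst k : gen (fun _ _ => k) (fun _ _ => k)
| gen_add u v u' v' of gen u v & gen u' v' :
    gen (fun x t => u x t + u' x t) (fun x t => v x t + v' x t)
| gen_mul u v u' v' of gen u v & gen u' v' :
    gen (fun x t => u x t * u' x t) (fun x t => v x t * v' x t)
| gen_dt u v of gen u v : gen (pdt H u) (pdt H v)
| gen_swap u v of gen u v : gen v u.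

Hypothesis base_smooth : forall u v, base u v -> smooth_quadrant u /\ smooth_quadrant v.
Hypothesis base_match : forall u v, base u v -> forall t, 0 <= t -> u 0 t = v 0 t.
(** The place where the differential equation enters: for the generators chosen later this is
    immediate on [q] and is the equation, solved for the second derivative, on [q_x]. *)
Hypothesis base_dx : forall u v, base u v -> gen (pdx H u) (fun x t => - pdx H v x t).

Lemma gen_opp u v : gen u v -> gen (fun x t => - u x t) (fun x t => - v x t).
Proof.
move=> /(gen_mul (gen_cst (-1))) /gen_ext; apply=> x t _ _; exact: mulN1r.
Qed.

Lemma gen_smooth u v : gen u v -> smooth_quadrant u /\ smooth_quadrant v.
Proof.
elim=> {u v}.
- exact: base_smooth.
- move=> u v u' v' _ [su sv] uu' vv'; split; [exact: eq_smooth_quadrant su|].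
  exact: eq_smooth_quadrant sv.
- by move=> k; split=> n; exact: Cn_cst.
- by move=> u v u' v' _ [su sv] _ [su' sv']; split=> n; exact: CnD.
- by move=> u v u' v' _ [su sv] _ [su' sv']; split=> n; exact: CnM.
- by move=> u v _ [su sv]; split; exact: smooth_quadrant_dt.
- by move=> u v _ [].
Qed.

(** The match holds along the whole boundary line [x = 0], so it may be differentiated in [t]; the
    other operations act pointwise. *)
Lemma gen_match u v : gen u v -> forall t, 0 <= t -> u 0 t = v 0 t.
Proof.
elim=> {u v}.
- exact: base_match.
- by move=> u v u' v' _ uv uu' vv' t t0; rewrite -uu'// -vv'// uv.
- by [].
- by move=> u v u' v' _ uv _ uv' t t0; rewrite uv// uv'.
- by move=> u v u' v' _ uv _ uv' t t0; rewrite uv// uv'.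
- move=> u v guv uv t t0; have [su sv] := gen_smooth guv.
  have Ht : H t by rewrite halflineE.
  apply: pdtE => //; apply: has_deriv_ext (pdt_deriv sv (lexx 0) t0) => // s.
  by rewrite halflineE => s0; rewrite uv.
- by move=> u v _ uv t t0; rewrite uv.
Qed.

(** By induction everything comes down to the generators: Leibniz' rule treats sums and products,
    [pdxC] moves d/dx past d/dt, and d/dx anticommutes with the reflection, so a swapped pair yields
    the opposite of the swapped derivative. *)
Lemma gen_dx u v : gen u v -> gen (pdx H u) (fun x t => - pdx H v x t).
Proof.
have pdxD (u1 u2 : R -> R -> R) x t : smooth_quadrant u1 -> smooth_quadrant u2 -> 0 <= x -> 0 <= t ->
    pdx H u1 x t + pdx H u2 x t = pdx H (fun x t => u1 x t + u2 x t) x t.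
  move=> s1 s2 x0 t0; apply/esym/pdxE; rewrite ?halflineE//.
  by apply: has_derivD; exact: pdx_deriv.
have pdxM (u1 u2 : R -> R -> R) x t : smooth_quadrant u1 -> smooth_quadrant u2 -> 0 <= x -> 0 <= t ->
    pdx H u1 x t * u2 x t + u1 x t * pdx H u2 x t = pdx H (fun x t => u1 x t * u2 x t) x t.
  move=> s1 s2 x0 t0; apply/esym/pdxE; rewrite ?halflineE//.
  by apply: has_derivM; exact: pdx_deriv.
elim=> {u v}.
- exact: base_dx.
- move=> u v u' v' guv IH uu' vv'; have [su sv] := gen_smooth guv.
  apply: gen_ext IH _ _ => x t x0 t0.
    by rewrite (eq_pdx su)// => y y0; exact: uu'.
  by rewrite (eq_pdx sv)// => y y0; exact: vv'.
- move=> k; have dk x t : 0 <= x -> 0 = pdx H (fun _ _ => k) x t.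
    move=> x0; apply/esym/pdxE; rewrite ?halflineE//; exact: has_deriv_cst.
  apply: gen_ext (gen_cst 0) _ _ => x t x0 t0; first exact: dk.
  by rewrite -dk// oppr0.
- move=> u v u' v' g IH g' IH'; have [su sv] := gen_smooth g; have [su' sv'] := gen_smooth g'.
  apply: gen_ext (gen_add IH IH') _ _ => x t x0 t0; first exact: pdxD.
  by rewrite -pdxD// opprD.
- move=> u v u' v' g IH g' IH'; have [su sv] := gen_smooth g; have [su' sv'] := gen_smooth g'.
  apply: gen_ext (gen_add (gen_mul IH g') (gen_mul g IH')) _ _ => x t x0 t0; first exact: pdxM.
  by rewrite -pdxM// opprD mulNr mulrN.
- move=> u v g IH; have [su sv] := gen_smooth g.
  apply: gen_ext (gen_dt IH) _ _ => x t x0 t0.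
    by rewrite (pdxC (su 2%N)).
  rewrite (pdxC (sv 2%N))//; apply: pdtE; rewrite ?halflineE//.
  by apply: has_derivN; apply: pdt_deriv => //; exact: smooth_quadrant_dx.
- move=> u v g IH; apply: gen_ext (gen_opp (gen_swap IH)) _ _ => x t x0 t0 //.
  exact: opprK.
Qed.

Lemma gen_glue_dx u v (x t : R) : gen u v -> 0 <= t ->
  has_deriv setT (glue u v ^~ t) x (glue (pdx H u) (fun x t => - pdx H v x t) x t).
Proof.
move=> guv t0; have [su sv] := gen_smooth guv.
by apply: pdx_glue => //; [exact: gen_match guv _ _|exact: gen_match (gen_dx guv) _ _].
Qed.

Lemma gen_glue_dt u v (x t : R) : gen u v -> 0 <= t ->
  has_deriv H (glue u v x) t (glue (pdt H u) (pdt H v) x t).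
Proof. by move=> /gen_smooth[su sv] t0; exact: pdt_glue. Qed.

(** Both partial derivatives of a glued pair from [gen] are again glued pairs from [gen], all of
    them continuous across 0; the induction on [n] therefore has to range over all pairs. *)
Lemma gen_glue_Cn n u v : gen u v -> Cn setT H n (glue u v).
Proof.
have cont w z (g : gen w z) :
    {within setT `*` H, continuous (fun p : R * R => glue w z p.1 p.2)}.
  have [sw sz] := gen_smooth g.
  apply: glue_continuous (gen_match g); [exact: Cn_continuous (sw 0%N)|].
  exact: Cn_continuous (sz 0%N).
elim: n u v => [|n IH] u v guv; first by split=> //; exact: cont.
apply: (Cn_intro (@limit_set_setT R) LH (cont _ _ guv) _ _
  (IH _ _ (gen_dx guv)) (IH _ _ (gen_dt guv))) => x t _; rewrite halflineE => t0.
- exact: gen_glue_dx.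
- exact: gen_glue_dt.
Qed.

End Gen.
End Folded.

(** * Complex-valued functions *)

Section ComplexAlgebra.
Context {R : realType}.
Local Notation C := R[i].

(** Solves the equation for the second derivative, in real coordinates: the right-hand sides involve
    only a time derivative and cubic terms, operations available in [gen]. Here [p] is the value of
    [q] whose conjugate enters the cubic term. *)
Lemma complex_nlsE (c : R) (zt zxx z p : C) :
  'i%C * zt + zxx - 2 * c%:C * (z * p^* * z) = 0 <->
  complex.Re zxx = complex.Im zt + 2 * c * ((complex.Re z * complex.Re z
    - complex.Im z * complex.Im z) * complex.Re p
    + 2 * (complex.Re z * complex.Im z) * complex.Im p) /\
  complex.Im zxx = - complex.Re zt + 2 * c * (2 * (complex.Re z * complex.Im z)
    * complex.Re p - (complex.Re z * complex.Re z
    - complex.Im z * complex.Im z) * complex.Im p).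
Proof.
case: zt zxx z p => [tr ti] [xr xi] [zr zi] [pr pi] /=.
rewrite -(rmorph_nat (real_complex R)); simpc; split.
  by move=> /eqP; rewrite eq_complex /= => /andP[/eqP E1 /eqP E2]; split; lra.
by move=> [E1 E2]; apply/eqP; rewrite eq_complex /=; apply/andP; split; apply/eqP; lra.
Qed.

(** Conjugate the equation and multiply by [c], which passes through conjugation because it is real;
    the result is the second AKNS equation for [r = c conj z], with [p] in the role of [q]. *)
Lemma nls_conj (c : R) (zt zxx z p : C) :
  'i%C * zt + zxx - 2 * c%:C * (z * p^* * z) = 0 ->
  - 'i%C * (c%:C * zt^*) + c%:C * zxx^*
    - 2 * (c%:C * z^* * p * (c%:C * z^*)) = 0.
Proof.
move=> /complex_nlsE; case: zt zxx z p => [tr ti] [xr xi] [zr zi] [pr pi] /= [E1 E2].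
rewrite -(rmorph_nat (real_complex R)); simpc; rewrite E1 E2.
by apply/eqP; rewrite eq_complex /=; apply/andP; split; apply/eqP; ring.
Qed.

Lemma diag2_inj (a d a' d' : C) : diag2 a d = diag2 a' d' <-> a = a' /\ d = d'.
Proof.
split=> [/matrixP h|[-> ->]//].
by have := h 0 0; have := h 1 1; rewrite !mxE /= => -> ->.
Qed.

Lemma mx22P (A B : 'M[C]_2) :
  [/\ A 0 0 = B 0 0, A 0 1 = B 0 1, A 1 0 = B 1 0 & A 1 1 = B 1 1] -> A = B.
Proof.
move=> [h00 h01 h10 h11]; apply/matrixP.
have ordE (i : 'I_2) : i = 0 \/ i = 1.
  by case: i => [[|[|]]] // k; [left|right]; exact: val_inj.
by move=> i j; case: (ordE i) => ->; case: (ordE j) => ->.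
Qed.

Lemma mul_mx22 (a b c d a' b' c' d' : C) : mx22 a b c d *m mx22 a' b' c' d' =
  mx22 (a * a' + b * c') (a * b' + b * d') (c * a' + d * c') (c * b' + d * d').
Proof.
by apply: mx22P; split; rewrite !mxE !big_ord_recl big_ord0 !mxE /= addr0.
Qed.

Lemma add_mx22 (a b c d a' b' c' d' : C) : mx22 a b c d + mx22 a' b' c' d' =
  mx22 (a + a') (b + b') (c + c') (d + d').
Proof. by apply: mx22P; split; rewrite !mxE. Qed.

Lemma opp_mx22 (a b c d : C) : - mx22 a b c d = mx22 (- a) (- b) (- c) (- d).
Proof. by apply: mx22P; split; rewrite !mxE. Qed.

Lemma scale_mx22 (k a b c d : C) : k *: mx22 a b c d = mx22 (k * a) (k * b) (k * c) (k * d).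
Proof. by apply: mx22P; split; rewrite !mxE. Qed.

Definition mx22E := (mul_mx22, add_mx22, opp_mx22, scale_mx22).

Lemma diag2_eq0 (a d : C) : diag2 a d = 0 <-> a = 0 /\ d = 0.
Proof.
have -> : (0 : 'M[C]_2) = diag2 0 0 by apply: mx22P; split; rewrite !mxE.
exact: diag2_inj.
Qed.

Lemma diag2_cubic (k a d a' d' a2 d2 b b' : C) :
  k *: diag2 a d + diag2 a' d' - 2 *: (diag2 a2 d2 *m diag2 b b' *m diag2 a2 d2) = 0 <->
  k * a + a' - 2 * (a2 * b * a2) = 0 /\ k * d + d' - 2 * (d2 * b' * d2) = 0.
Proof.
rewrite -diag2_eq0 /diag2 !mx22E.
by rewrite !(mulr0, mul0r, addr0, add0r, oppr0).
Qed.

Lemma sigma_diag2 (a d : C) : sigma *m diag2 a d *m sigma = diag2 d a.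
Proof.
rewrite /sigma /diag2 !mx22E.
by rewrite !(mulr0, mul0r, addr0, add0r, mulr1, mul1r).
Qed.

End ComplexAlgebra.

(** * Derivatives of complex functions and of diagonal matrices *)

Section ComplexDerivatives.
Context {R : realType}.
Local Notation C := R[i].
Local Notation H := (halfline : set R).
Let LH := @limit_set_halfline R.
Implicit Types u v q : R -> R -> C.

Definition re u (x t : R) : R := complex.Re (u x t).
Definition im u (x t : R) : R := complex.Im (u x t).

Lemma smooth_re u : smooth H H u -> smooth_quadrant (re u).
Proof. by move=> su n; have [] := su n. Qed.

Lemma smooth_im u : smooth H H u -> smooth_quadrant (im u).
Proof. by move=> su n; have [] := su n. Qed.

Lemma smooth_dx u : smooth H H u -> smooth H H (dx H u).
Proof.
by move=> su n; split; [exact: smooth_quadrant_dx (smooth_re su) n|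
  exact: smooth_quadrant_dx (smooth_im su) n].
Qed.

Lemma smooth0 : smooth H H (fun _ _ => 0 : C).
Proof. by move=> n; split; exact: Cn_cst. Qed.

Lemma eq_dx u v (x t : R) : smooth H H u -> 0 <= x -> 0 <= t ->
  (forall y, 0 <= y -> u y t = v y t) -> dx H v x t = dx H u x t.
Proof.
move=> su x0 t0 uv; congr (_ +i* _).
- by apply: eq_pdx (smooth_re su) _ _ _ => // y y0; rewrite /re uv.
- by apply: eq_pdx (smooth_im su) _ _ _ => // y y0; rewrite /im uv.
Qed.

Lemma dx_conjZ (c : R) u v (x t : R) : smooth H H u -> 0 <= x -> 0 <= t ->
  (forall y, 0 <= y -> v y t = c%:C * (u y t)^*) ->
  dx H v x t = c%:C * (dx H u x t)^*.
Proof.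
move=> su x0 t0 vu; have Hx : H x by rewrite halflineE.
rewrite /dx; simpc; congr (_ +i* _); apply: pdxE => //.
- apply: has_deriv_ext (has_derivZ (k := c) (pdx_deriv (smooth_re su) x0 t0)) => // y.
  by rewrite halflineE /re => y0; rewrite vu//; case: (u y t) => a b; simpc.
- rewrite -mulNr.
  apply: has_deriv_ext (has_derivZ (k := - c) (pdx_deriv (smooth_im su) x0 t0)) => // y.
  by rewrite halflineE /im => y0; rewrite vu//; case: (u y t) => a b; simpc.
Qed.

Lemma dt_conjZ (c : R) u v (x t : R) : smooth H H u -> 0 <= x -> 0 <= t ->
  (forall s, 0 <= s -> v x s = c%:C * (u x s)^*) ->
  dt H v x t = c%:C * (dt H u x t)^*.
Proof.
move=> su x0 t0 vu; have Ht : H t by rewrite halflineE.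
rewrite /dt; simpc; congr (_ +i* _); apply: pdtE => //.
- apply: has_deriv_ext (has_derivZ (k := c) (pdt_deriv (smooth_re su) x0 t0)) => // y.
  by rewrite halflineE /re => y0; rewrite vu//; case: (u x y) => a b; simpc.
- rewrite -mulNr.
  apply: has_deriv_ext (has_derivZ (k := - c) (pdt_deriv (smooth_im su) x0 t0)) => // y.
  by rewrite halflineE /im => y0; rewrite vu//; case: (u x y) => a b; simpc.
Qed.

Lemma dx0 (x t : R) : 0 <= x -> 0 <= t -> dx H (fun _ _ => 0 : C) x t = 0.
Proof.
(* The zero function is seen as [0] times its own conjugate. *)
move=> x0 t0; rewrite (@dx_conjZ 0 (fun _ _ => 0))//; first by rewrite mul0r.
- exact: smooth0.
- by move=> y _; rewrite mul0r.
Qed.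

Lemma dt0 (x t : R) : 0 <= x -> 0 <= t -> dt H (fun _ _ => 0 : C) x t = 0.
Proof.
move=> x0 t0; rewrite (@dt_conjZ 0 (fun _ _ => 0))//; first by rewrite mul0r.
- exact: smooth0.
- by move=> y _; rewrite mul0r.
Qed.

Lemma diag2_entry u v (i j : 'I_2) : (fun x t => diag2 (u x t) (v x t) i j) =
  if i == 0 then (if j == 0 then u else fun _ _ => 0) else (if j == 0 then fun _ _ => 0 else v).
Proof. by apply/funext => y; apply/funext => s; rewrite mxE; case: ifP; case: ifP. Qed.

Lemma mdt_diag2 u v (x t : R) : 0 <= x -> 0 <= t ->
  mdt (fun x t => diag2 (u x t) (v x t)) x t = diag2 (dt H u x t) (dt H v x t).
Proof.
by move=> x0 t0; apply: mx22P; split; rewrite !mxE diag2_entry//= dt0.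
Qed.

Lemma mdx_diag2 u v (x t : R) : 0 <= x -> 0 <= t ->
  mdx (fun x t => diag2 (u x t) (v x t)) x t = diag2 (dx H u x t) (dx H v x t).
Proof.
by move=> x0 t0; apply: mx22P; split; rewrite !mxE diag2_entry//= dx0.
Qed.

(** The formula for the inner derivative is known on the quadrant only, so it cannot be substituted
    as an equality of functions; [eq_dx] asks for agreement at [y >= 0] and no more. *)
Lemma mdx2_diag2 u v (x t : R) : smooth H H u -> smooth H H v -> 0 <= x -> 0 <= t ->
  mdx (mdx (fun x t => diag2 (u x t) (v x t))) x t =
  diag2 (dx H (dx H u) x t) (dx H (dx H v) x t).
Proof.
move=> su sv x0 t0; rewrite -mdx_diag2//; apply/matrixP => i j; rewrite !mxE.
apply: eq_dx => // [|y y0]; last by rewrite mdx_diag2.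
by rewrite (diag2_entry (dx H u) (dx H v)); case: ifP; case: ifP => _ _;
  [exact: smooth_dx|exact: smooth0..|exact: smooth_dx].
Qed.

Lemma akns_diag2 (k : C) u v (w z : C) (x t : R) :
  smooth H H u -> smooth H H v -> 0 <= x -> 0 <= t ->
  let F := fun x t => diag2 (u x t) (v x t) in
  k *: mdt F x t + mdx (mdx F) x t - 2 *: (F x t *m diag2 w z *m F x t) = 0 <->
  k * dt H u x t + dx H (dx H u) x t - 2 * (u x t * w * u x t) = 0 /\
  k * dt H v x t + dx H (dx H v) x t - 2 * (v x t * z * v x t) = 0.
Proof.
move=> su sv x0 t0 F; rewrite (mdx2_diag2 su sv x0 t0) (mdt_diag2 u v x0 t0).
exact: diag2_cubic.
Qed.

End ComplexDerivatives.

(** * The half-line problem and the equation on the line *)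

Section Unfolding.
Context {R : realType}.
Local Notation C := R[i].
Local Notation H := (halfline : set R).
Let LH := @limit_set_halfline R.

(* [b = false]: NLS; [b = true]: nonlocal NLS. *)
Definition gnls (b : bool) (c : R) (q : R -> R -> C) : Prop :=
  forall x t, 0 < t ->
    'i%C * dt H q x t + dx setT (dx setT q) x t
      - 2 * c%:C * (q x t * (q (if b then - x else x) t)^* * q x t) = 0.

Lemma pdx_restrict (W w : R -> R -> R) (x t l : R) : 0 <= x ->
  (forall y, 0 <= y -> w y t = W y t) ->
  has_deriv setT (W^~ t) x l -> pdx H w x t = l.
Proof.
move=> x0 wW /(has_deriv_sub (@subsetT _ H)) h; have Hx : H x by rewrite halflineE.
apply: pdxE => //; apply: has_deriv_ext h => // y.
by rewrite halflineE => y0; rewrite wW.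
Qed.

Lemma pdx_reflect (W w : R -> R -> R) (x t l : R) : 0 <= x ->
  (forall y, 0 <= y -> w y t = W (- y) t) ->
  has_deriv setT (W^~ t) (- x) l -> pdx H w x t = - l.
Proof.
move=> x0 wW /has_deriv_opp; rewrite opprK => /(has_deriv_sub (A := H)) h.
have Hx : H x by rewrite halflineE.
apply: pdxE => //; apply: has_deriv_ext (h _) => // y.
by rewrite halflineE => y0; rewrite wW.
Qed.

Section Restrict.
Variables (q q1 q2 : R -> R -> C).
Hypotheses (hq : unfolds q1 q2 q) (sq : smooth setT H q).

Let dxT (w : R -> R -> R) n (x t : R) : Cn setT H n.+1 w -> 0 <= t ->
  has_deriv setT (w^~ t) x (pdx setT w x t).
Proof. by move=> cw t0; apply: CnS_dx cw _ _; rewrite ?halflineE. Qed.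

Lemma unfold_dx (x t : R) : 0 <= x -> 0 <= t ->
  dx H q1 x t = dx setT q x t /\ dx H q2 x t = - dx setT q (- x) t.
Proof.
move=> x0 t0; have [sr si] : Cn setT H 1 (re q) /\ Cn setT H 1 (im q) := sq 1%N.
split; [congr (_ +i* _)|rewrite {2}/dx; simpc; congr (_ +i* _)].
- by apply: (pdx_restrict (W := re q) _ _ (dxT sr t0)) => // y y0; rewrite /re /im (hq y0 t0).1.
- by apply: (pdx_restrict (W := im q) _ _ (dxT si t0)) => // y y0; rewrite /re /im (hq y0 t0).1.
- by apply: (pdx_reflect (W := re q) _ _ (dxT sr t0)) => // y y0; rewrite /re /im (hq y0 t0).2.
- by apply: (pdx_reflect (W := im q) _ _ (dxT si t0)) => // y y0; rewrite /re /im (hq y0 t0).2.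
Qed.

Lemma unfold_dt (x t : R) : 0 <= x -> 0 <= t ->
  dt H q1 x t = dt H q x t /\ dt H q2 x t = dt H q (- x) t.
Proof.
move=> x0 t0; have Ht : H t by rewrite halflineE.
have E : forall s, H s -> q x s = q1 x s /\ q (- x) s = q2 x s.
  by move=> s; rewrite halflineE => s0; exact: hq.
have [sr si] : Cn setT H 1 (re q) /\ Cn setT H 1 (im q) := sq 1%N.
split; congr (_ +i* _); apply: pdtE => //.
- by apply: has_deriv_ext (CnS_dt sr _ Ht) => // s /E; rewrite /re /im => -[-> _].
- by apply: has_deriv_ext (CnS_dt si _ Ht) => // s /E; rewrite /re /im => -[-> _].
- by apply: has_deriv_ext (CnS_dt sr _ Ht) => // s /E; rewrite /re /im => -[_ ->].
- by apply: has_deriv_ext (CnS_dt si _ Ht) => // s /E; rewrite /re /im => -[_ ->].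
Qed.

Lemma unfold_dx2 (x t : R) : 0 <= x -> 0 <= t ->
  dx H (dx H q1) x t = dx setT (dx setT q) x t /\
  dx H (dx H q2) x t = dx setT (dx setT q) (- x) t.
Proof.
move=> x0 t0; have [/Cn_pdx sr /Cn_pdx si] :
    Cn setT H 2 (re q) /\ Cn setT H 2 (im q) := sq 2%N.
have E y : 0 <= y -> _ := fun y0 => unfold_dx y0 t0.
split; congr (_ +i* _).
- by apply: (pdx_restrict (W := pdx setT (re q)) _ _ (dxT sr t0)) => // y /E[-> _].
- by apply: (pdx_restrict (W := pdx setT (im q)) _ _ (dxT si t0)) => // y /E[-> _].
(* The first derivative of [q2] is already minus a reflected derivative; the second reflection
   cancels the sign. *)
- rewrite -[RHS]opprK; apply: (pdx_reflect (W := fun x t => - pdx setT (re q) x t)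
    _ _ (has_derivN (dxT sr t0))) => // y /E[_ ->].
  by rewrite /dx; simpc.
- rewrite -[RHS]opprK; apply: (pdx_reflect (W := fun x t => - pdx setT (im q) x t)
    _ _ (has_derivN (dxT si t0))) => // y /E[_ ->].
  by rewrite /dx; simpc.
Qed.

End Restrict.

Variables (b : bool) (c : R) (q0 r0 : R -> C) (q1 q2 r1 r2 : R -> R -> C).
Hypotheses (sq1 : smooth H H q1) (sq2 : smooth H H q2).
Hypotheses (sr1 : smooth H H r1) (sr2 : smooth H H r2).
Let Q := fun x t => diag2 (q1 x t) (q2 x t).
Let Rm := fun x t => diag2 (r1 x t) (r2 x t).
Let Q0 := fun x => diag2 (q0 x) (q0 (- x)).
Let R0 := fun x => diag2 (r0 x) (r0 (- x)).
(** The partner in the cubic term, folded: the component itself for NLS, its mirror image for the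
    nonlocal equation. Taking partners is an involution. *)
Let p1 := if b then q2 else q1.
Let p2 := if b then q1 else q2.
Hypothesis hr1 : forall x t, 0 <= x -> 0 <= t -> r1 x t = c%:C * (p1 x t)^*.
Hypothesis hr2 : forall x t, 0 <= x -> 0 <= t -> r2 x t = c%:C * (p2 x t)^*.

(** Conjugation by [sigma] swaps the diagonal entries, so each matrix identity states one scalar
    identity twice, up to sign. *)
Lemma boundary_conditionE u v : boundary_condition (fun x t => diag2 (u x t) (v x t)) <->
  forall t, 0 <= t -> u 0 t = v 0 t /\ dx H u 0 t = - dx H v 0 t.
Proof.
have E t : 0 <= t ->
    (diag2 (u 0 t) (v 0 t) - sigma *m diag2 (u 0 t) (v 0 t) *m sigma = 0 /\
     mdx (fun x t => diag2 (u x t) (v x t)) 0 t + sigma *m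
       mdx (fun x t => diag2 (u x t) (v x t)) 0 t *m sigma = 0) <->
    u 0 t = v 0 t /\ dx H u 0 t = - dx H v 0 t.
  move=> t0; rewrite mdx_diag2// !sigma_diag2 /diag2 !mx22E.
  rewrite !(subrr, addr0) -!/(diag2 _ _) !diag2_eq0; split.
    by move=> [[/eqP + _] [/eqP + _]]; rewrite subr_eq0 addr_eq0 => /eqP -> /eqP ->.
  by move=> [-> ->]; rewrite subrr addNr addrN.
by split=> h t t0; apply/E => //; exact: h.
Qed.

Lemma aknsE : akns Q Rm <-> forall x t, 0 < x -> 0 < t ->
  ('i%C * dt H q1 x t + dx H (dx H q1) x t - 2 * (q1 x t * r1 x t * q1 x t) = 0 /\
   'i%C * dt H q2 x t + dx H (dx H q2) x t - 2 * (q2 x t * r2 x t * q2 x t) = 0) /\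
  (- 'i%C * dt H r1 x t + dx H (dx H r1) x t - 2 * (r1 x t * q1 x t * r1 x t) = 0 /\
   - 'i%C * dt H r2 x t + dx H (dx H r2) x t - 2 * (r2 x t * q2 x t * r2 x t) = 0).
Proof.
split=> h x t x0 t0; have [h1 h2] := h x t x0 t0; have [x0' t0'] := (ltW x0, ltW t0).
  split; first exact: (akns_diag2 _ _ _ sq1 sq2 x0' t0').1 h1.
  exact: (akns_diag2 _ _ _ sr1 sr2 x0' t0').1 h2.
split; first exact: (akns_diag2 _ _ _ sq1 sq2 x0' t0').2 h1.
exact: (akns_diag2 _ _ _ sr1 sr2 x0' t0').2 h2.
Qed.

Lemma ibvp_of_line q : unfolds q1 q2 q -> smooth setT H q -> gnls b c q ->
  (forall x, q x 0 = q0 x /\ r0 x = c%:C * (q0 (if b then - x else x))^*) ->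
  half_line_ibvp Q0 R0 Q Rm.
Proof.
move=> hq sq nlsq initq.
have sp1 : smooth H H p1 by rewrite /p1; case: b.
have sp2 : smooth H H p2 by rewrite /p2; case: b.
(* At [x = 0] both components read off the same value and the same slope of [q], the second slope
   with reversed sign. *)
have bdq t : 0 <= t -> q1 0 t = q2 0 t /\ dx H q1 0 t = - dx H q2 0 t.
  move=> t0; have [<- <-] := hq _ _ (lexx 0) t0.
  by have [-> ->] := unfold_dx hq sq (lexx 0) t0; rewrite oppr0 opprK.
have e1 x t : 0 < x -> 0 < t -> 'i%C * dt H q1 x t + dx H (dx H q1) x t
    - 2 * c%:C * (q1 x t * (p1 x t)^* * q1 x t) = 0.
  move=> x0 t0; have [-> _] := unfold_dt hq sq (ltW x0) (ltW t0).
  have [-> _] := unfold_dx2 hq sq (ltW x0) (ltW t0).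
  have [E1 E2] := hq _ _ (ltW x0) (ltW t0).
  by rewrite -[RHS](nlsq x t t0) E1 /p1; case: (b); rewrite ?E1 ?E2.
have e2 x t : 0 < x -> 0 < t -> 'i%C * dt H q2 x t + dx H (dx H q2) x t
    - 2 * c%:C * (q2 x t * (p2 x t)^* * q2 x t) = 0.
  move=> x0 t0; have [_ ->] := unfold_dt hq sq (ltW x0) (ltW t0).
  have [_ ->] := unfold_dx2 hq sq (ltW x0) (ltW t0).
  have [E1 E2] := hq _ _ (ltW x0) (ltW t0).
  (* The second component satisfies the line equation taken at [- x], whose mirror point is [x]. *)
  by rewrite -[RHS](nlsq (- x) t t0) E2 /p2; case: (b); rewrite ?opprK ?E1 ?E2.
split.
- apply/aknsE => x t x0 t0; have [x0' t0'] := (ltW x0, ltW t0).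
  rewrite !hr1// !hr2//.
  have f1 := e1 x t x0 t0; have f2 := e2 x t x0 t0.
  split; first by split; [rewrite -f1|rewrite -f2]; ring.
  have -> : dt H r1 x t = c%:C * (dt H p1 x t)^*.
    by apply: dt_conjZ => // s s0; exact: hr1.
  have -> : dt H r2 x t = c%:C * (dt H p2 x t)^*.
    by apply: dt_conjZ => // s s0; exact: hr2.
  have -> : dx H (dx H r1) x t = c%:C * (dx H (dx H p1) x t)^*.
    apply: dx_conjZ => // [|y y0]; first exact: smooth_dx.
    by apply: dx_conjZ => // z z0; exact: hr1.
  have -> : dx H (dx H r2) x t = c%:C * (dx H (dx H p2) x t)^*.
    apply: dx_conjZ => // [|y y0]; first exact: smooth_dx.
    by apply: dx_conjZ => // z z0; exact: hr2.
  (* The equation for [r1] is the conjugate of the one for [p1], whose partner is [q1]; when [b]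
     holds, [e1] and [e2] exchange roles. *)
  by split; apply: nls_conj; move: f1 f2; rewrite /p1 /p2; case: (b).
- move=> x x0; have [E1 E2] := hq _ _ x0 (lexx 0).
  have [I1 J1] := initq x; have [I2 J2] := initq (- x).
  rewrite /Q /Rm hr1// hr2// /Q0 /R0 J1 J2 -I1 -I2 E1 E2 /p1 /p2.
  split=> //; case: (b); last by rewrite -I1 -I2 E1 E2.
  by rewrite opprK -I1 -I2 E1 E2.
- exact/boundary_conditionE.
- apply/boundary_conditionE => t t0; have [E1 E2] := bdq t t0.
  rewrite hr1// hr2//.
  rewrite (dx_conjZ sp1 (lexx 0) t0 (fun y y0 => hr1 y0 t0)).
  rewrite (dx_conjZ sp2 (lexx 0) t0 (fun y y0 => hr2 y0 t0)).
  by rewrite /p1 /p2; case: (b); rewrite E1 E2 ?rmorphN ?mulrN ?opprK.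
Qed.

(** Real and imaginary parts of [q] and [q_x] as folded pairs. That these match at 0 is exactly the
    boundary condition on [Q]. *)
Inductive initial_jet : (R -> R -> R) -> (R -> R -> R) -> Prop :=
| jet_re : initial_jet (re q1) (re q2)
| jet_im : initial_jet (im q1) (im q2)
| jet_dre : initial_jet (pdx H (re q1)) (fun x t => - pdx H (re q2) x t)
| jet_dim : initial_jet (pdx H (im q1)) (fun x t => - pdx H (im q2) x t).

Lemma line_of_ibvp : half_line_ibvp Q0 R0 Q Rm ->
  exists q, [/\ unfolds q1 q2 q, smooth setT H q, gnls b c q &
    forall x, q x 0 = q0 x /\ r0 x = c%:C * (q0 (if b then - x else x))^*].
Proof.
move=> [/aknsE hakns init /boundary_conditionE bdq _].
have [s1r s1i] := (smooth_re sq1, smooth_im sq1).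
have [s2r s2i] := (smooth_re sq2, smooth_im sq2).
have e1 x t : 0 < x -> 0 < t -> 'i%C * dt H q1 x t + dx H (dx H q1) x t
    - 2 * c%:C * (q1 x t * (p1 x t)^* * q1 x t) = 0.
  move=> x0 t0; have [[<- _] _] := hakns x t x0 t0.
  by rewrite hr1 ?ltW//; ring.
have e2 x t : 0 < x -> 0 < t -> 'i%C * dt H q2 x t + dx H (dx H q2) x t
    - 2 * c%:C * (q2 x t * (p2 x t)^* * q2 x t) = 0.
  move=> x0 t0; have [[_ <-] _] := hakns x t x0 t0.
  by rewrite hr2 ?ltW//; ring.
(* The right-hand sides of [complex_nlsE], with [-1 *] in place of subtraction so that they are
   literally built by the constructors of [gen]. *)
pose Fre (a d pa pd : R -> R -> R) (x t : R) := pdt H d x t + 2 * c *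
  ((a x t * a x t + -1 * (d x t * d x t)) * pa x t + 2 * (a x t * d x t) * pd x t).
pose Fim (a d pa pd : R -> R -> R) (x t : R) := -1 * pdt H a x t + 2 * c *
  (2 * (a x t * d x t) * pa x t + -1 * ((a x t * a x t + -1 * (d x t * d x t)) * pd x t)).
have gF a a' d d' pa pa' pd pd' : gen initial_jet a a' -> gen initial_jet d d' ->
    gen initial_jet pa pa' -> gen initial_jet pd pd' ->
    gen initial_jet (Fre a d pa pd) (Fre a' d' pa' pd') /\
    gen initial_jet (Fim a d pa pd) (Fim a' d' pa' pd').
  move=> ga gd gpa gpd; split; rewrite /Fre /Fim;
  repeat first [exact: gen_cst | assumption | apply: gen_dt | apply: gen_add | apply: gen_mul].
have base_smooth u v : initial_jet u v -> smooth_quadrant u /\ smooth_quadrant v.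
  case=> //; split; (try exact: smooth_quadrant_dx).
    apply: eq_smooth_quadrant (smooth_quadrantZ (-1) (smooth_quadrant_dx s2r)).
    by move=> x t _ _; rewrite mulN1r.
  apply: eq_smooth_quadrant (smooth_quadrantZ (-1) (smooth_quadrant_dx s2i)).
  by move=> x t _ _; rewrite mulN1r.
have base_match u v : initial_jet u v -> forall t, 0 <= t -> u 0 t = v 0 t.
  case=> t /bdq[E1]; rewrite /dx; simpc => -[E2 E3] //; first by rewrite /re E1.
  by rewrite /im E1.
have [gre gim] := (gen_base jet_re, gen_base jet_im).
have [gdre gdim] := (gen_base jet_dre, gen_base jet_dim).
(* In the nonlocal case the partner is the reflected pair; closure under reflection is needed
   here. *)
have [gpre gpim] : gen initial_jet (re p1) (re p2) /\ gen initial_jet (im p1) (im p2).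
  by rewrite /p1 /p2; case: (b); split=> //; exact: gen_swap.
have [gFre gFim] := gF _ _ _ _ _ _ _ _ gre gim gpre gpim.
(* Extends the solved equation to the closed quadrant, where equality with elements of [gen] has to
   hold. *)
have close u v f f' : smooth_quadrant u -> smooth_quadrant v -> gen initial_jet f f' ->
    (forall x t, 0 < x -> 0 < t -> pdx H (pdx H u) x t = f x t /\
      pdx H (pdx H v) x t = f' x t) ->
    forall x t, 0 <= x -> 0 <= t -> pdx H (pdx H u) x t = f x t /\
      pdx H (pdx H v) x t = f' x t.
  move=> su sv /(gen_smooth base_smooth)[sf sf'] h x t x0 t0; split.
    apply: eq_quadrant_interior x0 t0 => [||y s y0 s0]; last by have [] := h y s y0 s0.
      exact: Cn_continuous (smooth_quadrant_dx (smooth_quadrant_dx su) 0%N).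
    exact: Cn_continuous (sf 0%N).
  apply: eq_quadrant_interior x0 t0 => [||y s y0 s0]; last by have [] := h y s y0 s0.
    exact: Cn_continuous (smooth_quadrant_dx (smooth_quadrant_dx sv) 0%N).
  exact: Cn_continuous (sf' 0%N).
have Ere : forall x t, 0 <= x -> 0 <= t ->
    pdx H (pdx H (re q1)) x t = Fre (re q1) (im q1) (re p1) (im p1) x t /\
    pdx H (pdx H (re q2)) x t = Fre (re q2) (im q2) (re p2) (im p2) x t.
  apply: close => // x t x0 t0.
  have /complex_nlsE[E1 _] := e1 x t x0 t0; have /complex_nlsE[E2 _] := e2 x t x0 t0.
  by rewrite /Fre !mulN1r; split.
have Eim : forall x t, 0 <= x -> 0 <= t ->
    pdx H (pdx H (im q1)) x t = Fim (re q1) (im q1) (re p1) (im p1) x t /\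
    pdx H (pdx H (im q2)) x t = Fim (re q2) (im q2) (re p2) (im p2) x t.
  apply: close => // x t x0 t0.
  have /complex_nlsE[_ E1] := e1 x t x0 t0; have /complex_nlsE[_ E2] := e2 x t x0 t0.
  by rewrite /Fim !mulN1r; split.
have pdxN u x t : smooth_quadrant u -> 0 <= x -> 0 <= t ->
    - pdx H (fun x t => - u x t) x t = pdx H u x t.
  move=> su x0 t0; apply/eqP; rewrite eqr_oppLR; apply/eqP/pdxE; rewrite ?halflineE//.
  by apply: has_derivN; exact: pdx_deriv.
(* On the derivative generators the two signs cancel, leaving the pair of second derivatives, which
   the equation identifies with [Fre] and [Fim]. *)
have base_dx u v : initial_jet u v -> gen initial_jet (pdx H u) (fun x t => - pdx H v x t).
  case=> //.
    apply: gen_ext gFre _ _ => x t x0 t0; have [E1 E2] := Ere x t x0 t0 => //.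
    by rewrite pdxN//; exact: smooth_quadrant_dx.
  apply: gen_ext gFim _ _ => x t x0 t0; have [E1 E2] := Eim x t x0 t0 => //.
  by rewrite pdxN//; exact: smooth_quadrant_dx.
have q12 t : 0 <= t -> q1 0 t = q2 0 t by move=> /bdq[].
pose q x t := glue (re q1) (re q2) x t +i* glue (im q1) (im q2) x t.
have eta (z : C) : complex.Re z +i* complex.Im z = z by case: z.
have qpos x t : 0 <= x -> q x t = q1 x t.
  by move=> x0; rewrite /q /glue x0 /re /im eta.
have qneg x t : 0 <= x -> 0 <= t -> q (- x) t = q2 x t.
  move=> x0 t0; rewrite /q /glue oppr_ge0 opprK; case: leP => [x0'|_]; last exact: eta.
  have -> : x = 0 by apply: le_anti; rewrite x0 x0'.
  by rewrite oppr0 /re /im eta q12.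
have qE x t : 0 <= t -> q x t = if 0 <= x then q1 x t else q2 (- x) t.
  move=> t0; case: ifPn => [/qpos //|]; rewrite -ltNge => /ltW x0.
  by rewrite -qneg ?oppr_ge0// opprK.
exists q; split.
- by move=> x t x0 t0; rewrite qpos// qneg.
- by move=> n; split; exact: (gen_glue_Cn base_smooth base_match base_dx).
- have d2 u v x t : gen initial_jet u v -> gen initial_jet (pdx H u) (fun x t => - pdx H v x t) -> 0 <= t ->
      pdx setT (pdx setT (glue u v)) x t = glue (pdx H (pdx H u)) (pdx H (pdx H v)) x t.
    move=> g gd t0; have [su sv] := gen_smooth base_smooth g.
    have h := gen_glue_dx base_smooth base_match base_dx.
    apply: (pdxE (@limit_set_setT R)) => //.
    have -> : glue (pdx H (pdx H u)) (pdx H (pdx H v)) x t =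
        glue (pdx H (pdx H u)) (fun x t => - pdx H (fun x t => - pdx H v x t) x t) x t.
      rewrite /glue; case: leP => // /ltW x0; rewrite pdxN ?oppr_ge0//.
      exact: smooth_quadrant_dx.
    apply: (has_deriv_ext (f := fun y => glue (pdx H u) (fun x t => - pdx H v x t) y t)) => //;
      last exact: h gd t0.
    by move=> y _; rewrite (pdxE (@limit_set_setT R) _ (h _ _ y t g t0)).
  have d1 u v x t : gen initial_jet u v -> 0 <= t ->
      pdt H (glue u v) x t = glue (pdt H u) (pdt H v) x t.
    move=> g t0; apply: (pdtE LH); first by rewrite halflineE.
    exact: (gen_glue_dt base_smooth).
  move=> x t /ltW t0.
  have -> : dt H q x t = glue (pdt H (re q1)) (pdt H (re q2)) x t
      +i* glue (pdt H (im q1)) (pdt H (im q2)) x t by congr (_ +i* _); exact: d1.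
  have -> : dx setT (dx setT q) x t = glue (pdx H (pdx H (re q1))) (pdx H (pdx H (re q2))) x t
      +i* glue (pdx H (pdx H (im q1))) (pdx H (pdx H (im q2))) x t.
    by congr (_ +i* _); exact: d2.
  apply/complex_nlsE; rewrite !qE// /glue [complex.Re (_ +i* _)]/= [complex.Im (_ +i* _)]/=.
  case: (leP 0 x) => x0.
    have [-> _] := Ere x t x0 t0; have [-> _] := Eim x t x0 t0.
    have -> : (if 0 <= (if b then - x else x) then q1 (if b then - x else x) t
        else q2 (- (if b then - x else x)) t) = p1 x t.
      by rewrite -qE// /p1; case: (b); [rewrite qneg|rewrite qpos].
    by rewrite /Fre /Fim !mulN1r.
  have x0' : 0 <= - x by rewrite oppr_ge0 ltW.
  have [_ ->] := Ere (- x) t x0' t0; have [_ ->] := Eim (- x) t x0' t0.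
  have -> : (if 0 <= (if b then - x else x) then q1 (if b then - x else x) t
      else q2 (- (if b then - x else x)) t) = p2 (- x) t.
    by rewrite -qE// /p2; case: (b); [rewrite qpos|rewrite -qneg// opprK].
  by rewrite /Fre /Fim !mulN1r.
(* The reduction at [t = 0] forces the condition on [r0]; the two diagonal entries cover the two
   halves of the line. *)
- have initE x : 0 <= x -> [/\ q1 x 0 = q0 x, q2 x 0 = q0 (- x),
      r0 x = c%:C * (p1 x 0)^* & r0 (- x) = c%:C * (p2 x 0)^*].
    move=> x0; have [/diag2_inj[E1 E2] /diag2_inj[E3 E4]] := init x x0.
    by rewrite -E3 -E4 hr1// hr2.
  move=> x; have [x0|/ltW x0] := leP 0 x.
    have [E1 E2 E3 _] := initE x x0; rewrite qpos// E1 E3 /p1.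
    by case: (b); rewrite ?E1 ?E2.
  have x0' : 0 <= - x by rewrite oppr_ge0.
  have [E1 E2 _ E4] := initE _ x0'; rewrite opprK in E2 E4.
  rewrite -{1}(opprK x) qneg// E2 E4 /p2.
  by case: (b); rewrite ?E1 ?E2.
Qed.

Lemma ibvp_iff_line : half_line_ibvp Q0 R0 Q Rm <->
  exists q, [/\ unfolds q1 q2 q, smooth setT H q, gnls b c q &
    forall x, q x 0 = q0 x /\ r0 x = c%:C * (q0 (if b then - x else x))^*].
Proof.
by split=> [|[q [uq sq nq iq]]]; [exact: line_of_ibvp|exact: ibvp_of_line iq].
Qed.

End Unfolding.

(** * The reduction of the Lax matrix *)

Section Reduction.
Context {R : realType}.
Local Notation C := R[i].

Lemma laxUE (Q Rm : 'M[C]_2) k :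
  laxU Q Rm k = block_mx (- 'i%C * k)%:M Q Rm ('i%C * k)%:M.
Proof.
rewrite /laxU /Sigma3 scale_block_mx add_block_mx !scaler0 !addr0 !add0r.
by congr block_mx; rewrite ?scalerN scalemx1 // mulNr raddfN opprK.
Qed.

Lemma dagger_scalar (a : C) : dagger (a%:M : 'M[C]_2) = (conjc a)%:M.
Proof. by rewrite /dagger map_scalar_mx tr_scalar_mx. Qed.

(** The conjugate of [- i k] is [- i] times minus the conjugate of [k], so the dagger is again a Lax
    matrix, with [Q] and [R] exchanged. *)
Lemma dagger_laxU (Q Rm : 'M[C]_2) k :
  dagger (laxU Q Rm k) = laxU (dagger Rm) (dagger Q) (- k^*).
Proof.
rewrite !laxUE /dagger map_block_mx tr_block_mx -!/(dagger _) !dagger_scalar.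
by congr block_mx; congr (_ %:M); case: k => a b; simpc.
Qed.

(** [sigma_s] is chosen so that the factor [eps] and the dagger restore [k], and [B] commutes with
    [Sigma3]: the diagonal blocks are reproduced, and only the off-diagonal ones carry a
    constraint. *)
Lemma local_actionE (eps : C) (Bp Bm Q Rm : 'M[C]_2) k : eps = 1 \/ eps = -1 ->
  Bp \in unitmx -> Bm \in unitmx ->
  local_action eps (block_mx Bp 0 0 Bm) (laxU Q Rm) k =
  laxU (eps *: (Bp *m dagger Rm *m invmx Bm)) (eps *: (Bm *m dagger Q *m invmx Bp)) k.
Proof.
move=> heps uBp uBm.
have Ek : eps * - (sigma_s eps k)^* = k.
  by rewrite /sigma_s; case: heps => ->; case: k => a b; rewrite ?divr1 ?invrN1; simpc.
have uB : block_mx Bp 0 0 Bm \in unitmx by rewrite block_diag_mx_unit uBp.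
rewrite /local_action dagger_laxU !laxUE invmx_block_diag// !mulmx_block.
rewrite !(mulmx0, mul0mx, addr0, add0r) scale_block_mx; congr block_mx.
- rewrite scalar_mxC -mulmxA mulmxV// mulmx1 scale_scalar_mx; congr (_ %:M).
  by rewrite mulrCA Ek.
- rewrite scalar_mxC -mulmxA mulmxV// mulmx1 scale_scalar_mx; congr (_ %:M).
  by rewrite mulrCA Ek.
Qed.

Lemma laxU_inj (Q Rm Q' Rm' : 'M[C]_2) k : laxU Q Rm k = laxU Q' Rm' k <-> Q = Q' /\ Rm = Rm'.
Proof.
rewrite !laxUE; split=> [/eq_block_mx[_ -> -> _]//|[-> ->]//].
Qed.

Lemma dagger_diag2 (a d : C) : dagger (diag2 a d) = diag2 a^* d^*.
Proof. by apply: mx22P; split; rewrite !mxE //= oppr0. Qed.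

Lemma invmx_unique (n : nat) (A B : 'M[C]_n) : A *m B = 1%:M -> A \in unitmx /\ invmx A = B.
Proof.
move=> AB; have [uA _] := mulmx1_unit AB; split=> //.
by rewrite -[LHS]mulmx1 -AB mulmxA mulVmx// mul1mx.
Qed.

(* [b] tells whether conjugation by [J] exchanges the two diagonal entries. *)
Lemma reduction_diag2 (b : bool) (eps sp sm : C) (c : R) (J J' : 'M[C]_2)
    (q1 q2 r1 r2 : R -> R -> C) :
  eps = 1 \/ eps = -1 -> sp != 0 -> sm != 0 -> J *m J' = 1%:M ->
  (forall a d, J *m diag2 a d *m J' = if b then diag2 d a else diag2 a d) ->
  eps * (sm / sp) = c%:C ->
  let Q := fun x t => diag2 (q1 x t) (q2 x t) in
  let Rm := fun x t => diag2 (r1 x t) (r2 x t) in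
  let red := forall x t, 0 <= x -> 0 <= t ->
    Rm x t = eps *: ((sm *: J) *m dagger (Q x t) *m invmx (sp *: J)) in
  (local_reduction eps (sp *: J) (sm *: J) Q Rm <-> red) /\
  (red -> forall x t, 0 <= x -> 0 <= t ->
    r1 x t = c%:C * ((if b then q2 else q1) x t)^* /\
    r2 x t = c%:C * ((if b then q1 else q2) x t)^*).
Proof.
move=> heps sp0 sm0 JJ' swapJ hc Q Rm red.
have unitJ s : s != 0 -> s *: J \in unitmx /\ invmx (s *: J) = s^-1 *: J'.
  move=> s0; apply: invmx_unique.
  by rewrite -scalemxAl -scalemxAr scalerA JJ' divff// scale1r.
have [up ip] := unitJ _ sp0; have [um im] := unitJ _ sm0.
have conjE s s' a d : eps *: ((s *: J) *m dagger (diag2 a d) *m (s'^-1 *: J')) =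
    (eps * (s / s')) *: (if b then diag2 d^* a^* else diag2 a^* d^*).
  by rewrite dagger_diag2 -!scalemxAl -scalemxAr !scalerA swapJ mulrA.
have redE x t : Rm x t = eps *: ((sm *: J) *m dagger (Q x t) *m invmx (sp *: J)) <->
    r1 x t = c%:C * ((if b then q2 else q1) x t)^* /\
    r2 x t = c%:C * ((if b then q1 else q2) x t)^*.
  rewrite ip conjE hc /Rm; case: (b); rewrite /diag2 !mx22E !mulr0; exact: diag2_inj.
split; last by move=> h x t x0 t0; apply/redE; exact: h.
split=> [h x t x0 t0|h x t x0 t0 k].
  (* The off-diagonal blocks do not depend on [k], so the value [k = 0] suffices. *)
  by have := h x t x0 t0 0; rewrite local_actionE// => /laxU_inj[_].
rewrite local_actionE//; apply/laxU_inj; split; last exact: h.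
have [E1 E2] := (redE x t).1 (h x t x0 t0).
(* The [Q] block asks for the inverse relation: its scalar is [1 / c] because [eps] squares to 1,
   and conjugating twice is harmless because [c] is real. *)
have cV : (eps * (sp / sm)) * c%:C = 1.
  have ee : eps * eps = 1 by case: heps => ->; rewrite ?mulrNN mulr1.
  by rewrite -hc mulrACA ee mul1r mulf_div (mulrC sp) divff// mulf_neq0.
have cc z : (c%:C * z^*)^* = c%:C * z by case: z => a d; simpc.
have cVK z : eps * (sp / sm) * (c%:C * z) = z by rewrite mulrA cV mul1r.
by rewrite im conjE E1 E2 !cc /Q; case: (b); rewrite /diag2 scale_mx22 !mulr0 !cVK.
Qed.

Lemma phase_neq0 (theta : R) : phase theta != 0.
Proof.
apply/eqP => -[c0 s0]; have := cos2Dsin2 (theta / 2).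
rewrite c0; move/eqP: s0; rewrite oppr_eq0 => /eqP ->; rewrite !expr0n /= addr0.
by move=> /esym/eqP; rewrite oner_eq0.
Qed.

Lemma nlsE (c : R) q : nls c%:C q <-> gnls false c q.
Proof.
split=> h x t t0; rewrite -[RHS](h x t t0) sqr_normc; congr (_ - _); rewrite -!mulrA; congr (_ * (_ * _));
  by rewrite ?mulrA.
Qed.

End Reduction.
Theorem proposition3p2 (R : realType) (eps : R[i]) (theta : R) (mu : R[i])
    (q0 r0 : R -> R[i]) (q1 q2 r1 r2 : R -> R -> R[i])
    (heps : eps = 1 \/ eps = -1) (hmu : mu = 1 \/ mu = -1)
    (hq0 : schwartz q0) (hr0 : schwartz r0)
    (hq1 : admissible q1) (hq2 : admissible q2)
    (hr1 : admissible r1) (hr2 : admissible r2) :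
  let Q := fun x t => diag2 (q1 x t) (q2 x t) in
  let Rm := fun x t => diag2 (r1 x t) (r2 x t) in
  let Q0 := fun x => diag2 (q0 x) (q0 (- x)) in
  let R0 := fun x => diag2 (r0 x) (r0 (- x)) in
  (* type gamma = 1 *)
  (forall rhop rhom : R, rhop != 0 -> rhom != 0 ->
     let Bp := Bpos theta mu rhop in
     let Bm := Bpos theta mu rhom in
     let c : R[i] := eps * (rhom / rhop)%:C in
     (local_reduction eps Bp Bm Q Rm <->
      forall x t, 0 <= x -> 0 <= t ->
        Rm x t = eps *: (Bm *m dagger (Q x t) *m invmx Bp)) /\
     (local_reduction eps Bp Bm Q Rm ->
      (half_line_ibvp Q0 R0 Q Rm <->
       exists q : R -> R -> R[i],
         [/\ unfolds q1 q2 q,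
             smooth setT halfline q,
             nls c q &
             forall x, q x 0 = q0 x /\ r0 x = c * (q0 x)^*]))) /\
  (* type gamma = -1 *)
  (forall betap betam : R[i], betap != 0 -> betam != 0 ->
     (complex.Im betap = 0 /\ complex.Im betam = 0) \/ (complex.Re betap = 0 /\ complex.Re betam = 0) ->
     let Bp := Bneg theta mu betap in
     let Bm := Bneg theta mu betam in
     let c : R[i] := eps * (betam / betap) in
     [/\ c \is Num.real,
         local_reduction eps Bp Bm Q Rm <->
         forall x t, 0 <= x -> 0 <= t ->
           Rm x t = eps *: (Bm *m dagger (Q x t) *m invmx Bp) &
         local_reduction eps Bp Bm Q Rm ->
         (half_line_ibvp Q0 R0 Q Rm <->
          exists q : R -> R -> R[i],
            [/\ unfolds q1 q2 q,
                smooth setT halfline q,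
                nonlocal_nls c q &
                forall x, q x 0 = q0 x /\ r0 x = c * (q0 (- x))^*])]).
Proof.
move=> Q Rm Q0 R0.
have [sq1 _ _ _] := hq1; have [sq2 _ _ _] := hq2.
have [sr1 _ _ _] := hr1; have [sr2 _ _ _] := hr2.
have mm : mu * mu = 1 by case: hmu => ->; rewrite ?mulrNN mulr1.
have id2 : 1%:M = diag2 (1 : R[i]) 1 by apply: mx22P; split; rewrite !mxE.
have [e he] : exists e : R, eps = e%:C.
  by case: heps => ->; [exists 1|exists (-1)]; rewrite ?rmorphN rmorph1.
have ph0 := phase_neq0 theta.
(* The common phase cancels, so [theta] does not enter the coefficient [c]. *)
have phM (s s' : R[i]) : phase theta * s / (phase theta * s') = s / s'.
  by rewrite -mulf_div divff// mul1r.
have iff_line b (c : R) (hr : forall x t, 0 <= x -> 0 <= t ->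
    r1 x t = c%:C * ((if b then q2 else q1) x t)^* /\
    r2 x t = c%:C * ((if b then q1 else q2) x t)^*) :=
  ibvp_iff_line q0 r0 sq1 sq2 sr1 sr2 (fun x t x0 t0 => (hr x t x0 t0).1)
    (fun x t x0 t0 => (hr x t x0 t0).2).
split.
- move=> rhop rhom p0 m0 Bp Bm c.
  have cE : c = (e * (rhom / rhop))%:C by rewrite /c he -rmorphM.
  have realC_neq0 (s : R) : s != 0 -> phase theta * s%:C != 0.
    by move=> s0; rewrite mulf_neq0// fmorph_eq0.
  have [|||h1 h2] := @reduction_diag2 R false eps (phase theta * rhop%:C)
    (phase theta * rhom%:C) (e * (rhom / rhop)) (mx22 1 0 0 mu) (mx22 1 0 0 mu)
    q1 q2 r1 r2 heps (realC_neq0 _ p0) (realC_neq0 _ m0).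
  + by rewrite id2 mul_mx22 mm !(mulr0, mul0r, addr0, add0r, mulr1).
  + move=> a d; rewrite /diag2 !mul_mx22 !(mulr0, mul0r, addr0, add0r, mulr1, mul1r).
    by rewrite mulrAC mm mul1r.
  + by rewrite phM -cE /c fmorph_div.
  split; first exact: h1.
  move=> /h1/h2 red; rewrite cE; apply: iff_trans (iff_line false _ red) _.
  split=> -[q [uq sq nq iq]]; exists q; split;
    [exact: uq|exact: sq|exact/nlsE|exact: iq|exact: uq|exact: sq|exact/nlsE|exact: iq].
- move=> betap betam p0 m0 hb Bp Bm c.
  (* For two purely imaginary numbers the factor [i] cancels in the quotient, leaving the ratio of
     imaginary parts. *)
  have [d dE] : exists d : R, betam / betap = d%:C.
    case: betap betam p0 m0 hb {Bp Bm c} => [a b] [a' b'] p0 m0 /= [[]|[]] ? ?; subst.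
      by exists (a' / a); rewrite fmorph_div.
    exists (b' / b); apply: (canLR (mulfK p0)).
    have b0 : b != 0 by apply: contra_neq p0 => ->.
    by apply/eqP; rewrite eq_complex /= !(mul0r, mulr0, subr0, addr0) divfK ?eqxx.
  have cE : c = (e * d)%:C by rewrite /c he dE -rmorphM.
  (* The second matrix inverts the first because [mu] squares to 1; conjugation by this antidiagonal
     matrix exchanges the entries of a diagonal one, the source of the nonlocality. *)
  have [|||h1 h2] := @reduction_diag2 R true eps (phase theta * betap)
    (phase theta * betam) (e * d) (mx22 0 1 mu 0) (mx22 0 mu 1 0)
    q1 q2 r1 r2 heps (mulf_neq0 ph0 p0) (mulf_neq0 ph0 m0).
  + by rewrite id2 mul_mx22 mm !(mulr0, mul0r, addr0, add0r, mulr1).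
  + move=> a a'; rewrite /diag2 !mul_mx22 !(mulr0, mul0r, addr0, add0r, mulr1, mul1r).
    by rewrite mulrAC mm mul1r.
  + by rewrite phM -cE.
  split; [by rewrite cE; apply/complex_realP; exists (e * d)|exact: h1|].
  by move=> /h1/h2 red; rewrite cE; exact: iff_line true _ red.
Qed.
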